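(* Let $R$ be any commutative ring and let $D=(d_1,\dots,d_m)$ be any sequence of nonnegative integers, with $N=\sum d_i$ and $q=\sum_i\lfloor d_i/2\rfloor$. Then the $R$-algebra $W_D$ is free as an $R$-module. Moreover, if $d_m$ is even, then the annihilator $\mathrm{Ann}(\mathrm{e}_m)\subseteq W_D$ is a principal ideal $(x)$, where \begin{itemize} \item (even) $x=\prod_{j\neq m}\mathrm{e}_j$ if all $d_j$ are even, and \item (odd) $x=\mathrm{e}_m\cdot\prod_{j\neq m}\mathrm{p}_{\mathrm{top}}(\mathcal{D}_j)$ otherwise. \end{itemize} In the even case $x$ is an element of degree $N-d_m$, and in the odd case $x$ is an element of degree $4q-d_m$.
   Context: Definition of $W_D$. Let $\Sigma_D$ be the commutative graded $R$-algebra with generators (formal symbols) $\mathrm{p}_{2j}(\mathcal{D}_i)$ of degree $4j$, for $i=1,\dots,m$ and $j=1,\dots,\lfloor d_i/2\rfloor$, and $\mathrm{e}_i$ of degree $d_i$, for $i=1,\dots,m$, subject to the relations \begin{itemize} \item $\prod_{i=1}^m\mathrm{p}(\mathcal{D}_i)=1$, where $\mathrm{p}(\mathcal{D}_i)=1+\mathrm{p}_2(\mathcal{D}_i)+\mathrm{p}_4(\mathcal{D}_i)+\cdots+\mathrm{p}_{2\lfloor d_i/2\rfloor}(\mathcal{D}_i)$ (i.e. all positive-degree homogeneous components of the product vanish); \item $\mathrm{e}_i=0$ if $d_i$ is odd; \item $\mathrm{e}_i^2=\mathrm{p}_{d_i}(\mathcal{D}_i)$ if $d_i$ is even; \item $\prod_{i=1}^m\mathrm{e}_i=0$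 if all $d_i$ are even. \end{itemize} Write $\mathrm{p}_{\mathrm{top}}(\mathcal{D}_i)=\mathrm{p}_{2\lfloor d_i/2\rfloor}(\mathcal{D}_i)$, with $\mathrm{p}_0=1$. Let $\Lambda=\bigwedge_{l=q+1}^n\langle\mathrm{R}_l\rangle$ be the exterior $R$-algebra on generators $\mathrm{R}_{q+1},\dots,\mathrm{R}_n$, $n=\lfloor N/2\rfloor$, with $\deg\mathrm{R}_l=4l-1$ except that $\deg \mathrm{R}_n=N-1$ if $N$ is even. Then $W_D:=\Sigma_D\otimes_R\Lambda$.
   Formalization: In the odd case the equality Ann(e_m) = (x) is claimed only for q > 0; for q = 0 it fails over every nonzero R, e.g. D = (1,0), where e_2^2 = 1, so x = e_2 is a unit while Ann(e_2) = 0. *)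

(* Defs.v *)
From HB Require Import structures.
From mathcomp Require Import all_boot all_order all_algebra.
From mathcomp Require Import finmap boolp classical_sets.

Set Implicit Arguments.
Unset Strict Implicit.
Unset Printing Implicit Defensive.

Import GRing.Theory.

Local Open Scope ring_scope.
Local Open Scope quotient_scope.

(** An R-algebra is given below by a [pzRingType] with a central ring morphism
    from R, and [a *: x] is multiplication by the image of [a].  MathComp's
    [algType R] is not usable: it requires [1 != 0], while the algebras below
    can vanish (Sigma_D does for D = (0), and everything does when R = 0). *)

(** Bases may be infinite. *)
Definition is_free (R : pzRingType) (V : lmodType R) : Prop :=
  exists (I : choiceType) (b : I -> V), forall v : V,
    exists! c : {fsfun I -> R with 0}, v = \sum_(i <- finsupp c) c i *: b i.

(** Left annihilator; used below only for central elements. *)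
Definition annihilator (A : pzRingType) (a : A) : set A :=
  [set w | a * w = 0]%classic.

(** The two-sided ideal generated by [x]. *)
Definition principal_ideal (A : pzRingType) (x : A) : set A :=
  [set w | exists s : seq (A * A), w = \sum_(u <- s) u.1 * x * u.2]%classic.

(** [homog iA base k a]: [a] is homogeneous of degree [k] when the elements of
    [base k] are given degree [k] and scalars (the image of [iA]) degree 0.
    As usual, 0 is homogeneous of every degree. *)
Inductive homog (R A : pzRingType) (iA : R -> A) (base : nat -> A -> Prop) :
    nat -> A -> Prop :=
| homog_base k a : base k a -> homog iA base k a
| homog_zero k : homog iA base k 0
| homog_add k a b : homog iA base k a -> homog iA base k b ->
    homog iA base k (a + b)
| homog_cst (r : R) : homog iA base 0 (iA r)
| homog_mul k l a b : homog iA base k a -> homog iA base l b ->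
    homog iA base (k + l)%N (a * b).

(** * Algebras presented by generators and relations *)

Inductive term (R G : Type) : Type :=
| Cst of R
| Gen of G
| Add of term R G & term R G
| Mul of term R G & term R G.

Arguments Cst {R G}.
Arguments Gen {R G}.
Arguments Add {R G}.
Arguments Mul {R G}.

HB.instance Definition _ (R G : Type) := gen_eqMixin (term R G).
HB.instance Definition _ (R G : Type) := gen_choiceMixin (term R G).

Section Presentation.
Variables (R : comPzRingType) (G : Type) (rel : term R G -> term R G -> Prop).

(** The smallest congruence that contains [rel] and makes the quotient an
    associative unital R-algebra. *)
Inductive congr : term R G -> term R G -> Prop :=
| congr_rel s t : rel s t -> congr s t
| congr_refl s : congr s s
| congr_sym s t : congr s t -> congr t s
| congr_trans s t u : congr s t -> congr t u -> congr s u
| congr_Add s s' t t' : congr s s' -> congr t t' -> congr (Add s t) (Add s' t')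
| congr_Mul s s' t t' : congr s s' -> congr t t' -> congr (Mul s t) (Mul s' t')
| congr_addA s t u : congr (Add s (Add t u)) (Add (Add s t) u)
| congr_addC s t : congr (Add s t) (Add t s)
| congr_add0 s : congr (Add (Cst 0) s) s
| congr_addN s : congr (Add (Mul (Cst (- 1)) s) s) (Cst 0)
| congr_mulA s t u : congr (Mul s (Mul t u)) (Mul (Mul s t) u)
| congr_mul1t s : congr (Mul (Cst 1) s) s
| congr_mult1 s : congr (Mul s (Cst 1)) s
| congr_mulDl s t u : congr (Mul (Add s t) u) (Add (Mul s u) (Mul t u))
| congr_mulDr s t u : congr (Mul s (Add t u)) (Add (Mul s t) (Mul s u))
| congr_CstD a b : congr (Cst (a + b)) (Add (Cst a) (Cst b))
| congr_CstM a b : congr (Cst (a * b)) (Mul (Cst a) (Cst b))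
| congr_CstC a s : congr (Mul (Cst a) s) (Mul s (Cst a)).

Definition congrb (s t : term R G) : bool := `[< congr s t >].

Lemma congrb_equiv : equiv_class_of congrb.
Proof.
split=> [s|s t|t s u]; first exact/asboolP/congr_refl.
  by apply/asboolP/asboolP; exact: congr_sym.
by move=> /asboolP st /asboolP tu; apply/asboolP; exact: congr_trans st tu.
Qed.

Canonical congrb_equivRel := EquivRelPack congrb_equiv.
Canonical congrb_encModRel := defaultEncModRel congrb.

Definition presented : Type := {eq_quot congrb}.

HB.instance Definition _ := Choice.on presented.
HB.instance Definition _ := EqQuotient.on presented.

Definition cls (t : term R G) : presented := \pi_presented t.

Lemma clsP s t : cls s = cls t <-> congr s t.
Proof.
rewrite /cls; split=> [/eqmodP/asboolP //|st].
by apply/eqmodP/asboolP.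
Qed.

Lemma cls_repr (x : presented) : cls (repr x) = x.
Proof. exact: reprK. Qed.

Lemma congr_repr t : congr (repr (cls t)) t.
Proof. by apply/clsP; rewrite cls_repr. Qed.

Definition pres_zero : presented := cls (Cst 0).
Definition pres_one : presented := cls (Cst 1).
Definition pres_add (x y : presented) : presented := cls (Add (repr x) (repr y)).
Definition pres_mul (x y : presented) : presented := cls (Mul (repr x) (repr y)).
Definition pres_scale (a : R) (x : presented) : presented :=
  cls (Mul (Cst a) (repr x)).
Definition pres_opp (x : presented) : presented := pres_scale (- 1) x.

Lemma pres_addE s t : pres_add (cls s) (cls t) = cls (Add s t).
Proof. by apply/clsP; apply: congr_Add; exact: congr_repr. Qed.

Lemma pres_mulE s t : pres_mul (cls s) (cls t) = cls (Mul s t).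
Proof. by apply/clsP; apply: congr_Mul; exact: congr_repr. Qed.

Lemma pres_scaleE a s : pres_scale a (cls s) = cls (Mul (Cst a) s).
Proof. by apply/clsP; apply: congr_Mul (congr_refl _) (congr_repr _). Qed.

Let presE := (pres_addE, pres_mulE, pres_scaleE).

Lemma presW (P : presented -> Prop) : (forall t, P (cls t)) -> forall x, P x.
Proof. by move=> Pt x; rewrite -[x]cls_repr. Qed.

Lemma pres_addA : associative pres_add.
Proof.
do 3![elim/presW=> ?]; rewrite !presE; apply/clsP; exact: congr_addA.
Qed.

Lemma pres_addC : commutative pres_add.
Proof. do 2![elim/presW=> ?]; rewrite !presE; apply/clsP; exact: congr_addC. Qed.

Lemma pres_add0 : left_id pres_zero pres_add.
Proof. elim/presW=> ?; rewrite !presE; apply/clsP; exact: congr_add0. Qed.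

Lemma pres_addN : left_inverse pres_zero pres_opp pres_add.
Proof.
elim/presW=> ?; rewrite /pres_opp !presE; apply/clsP; exact: congr_addN.
Qed.

HB.instance Definition _ :=
  GRing.isZmodule.Build presented pres_addA pres_addC pres_add0 pres_addN.

Lemma pres_mulA : associative pres_mul.
Proof.
do 3![elim/presW=> ?]; rewrite !presE; apply/clsP; exact: congr_mulA.
Qed.

Lemma pres_mul1x : left_id pres_one pres_mul.
Proof. elim/presW=> ?; rewrite !presE; apply/clsP; exact: congr_mul1t. Qed.

Lemma pres_mulx1 : right_id pres_one pres_mul.
Proof. elim/presW=> ?; rewrite !presE; apply/clsP; exact: congr_mult1. Qed.

Lemma pres_mulDl : left_distributive pres_mul pres_add.
Proof.
do 3![elim/presW=> ?]; rewrite !presE; apply/clsP; exact: congr_mulDl.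
Qed.

Lemma pres_mulDr : right_distributive pres_mul pres_add.
Proof.
do 3![elim/presW=> ?]; rewrite !presE; apply/clsP; exact: congr_mulDr.
Qed.

HB.instance Definition _ := GRing.Zmodule_isPzRing.Build presented
  pres_mulA pres_mul1x pres_mulx1 pres_mulDl pres_mulDr.

Lemma pres_scaleA a b x : pres_scale a (pres_scale b x) = pres_scale (a * b) x.
Proof.
elim/presW: x => t; rewrite !presE; apply/clsP.
apply: congr_trans (congr_mulA _ _ _) _.
exact: congr_Mul (congr_sym (congr_CstM _ _)) (congr_refl _).
Qed.

Lemma pres_scale1 : left_id 1 pres_scale.
Proof. elim/presW=> ?; rewrite !presE; apply/clsP; exact: congr_mul1t. Qed.

Lemma pres_scaleDr : right_distributive pres_scale +%R.
Proof.
move=> a; do 2![elim/presW=> ?]; rewrite /+%R /= !presE; apply/clsP.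
exact: congr_mulDr.
Qed.

Lemma pres_scaleDl x : {morph pres_scale^~ x : a b / a + b}.
Proof.
move=> a b; elim/presW: x => t; rewrite [RHS]/+%R /= !presE; apply/clsP.
apply: congr_trans (congr_mulDl _ _ _).
exact: congr_Mul (congr_CstD _ _) (congr_refl _).
Qed.

HB.instance Definition _ := GRing.Zmodule_isLmodule.Build R presented
  pres_scaleA pres_scale1 pres_scaleDr pres_scaleDl.

Lemma pres_scaleAl (a : R) (x y : presented) : a *: (x * y) = (a *: x) * y.
Proof.
elim/presW: x => s; elim/presW: y => t.
rewrite /*%R /= /GRing.scale /= !presE; apply/clsP; exact: congr_mulA.
Qed.

Lemma pres_scaleAr (a : R) (x y : presented) : a *: (x * y) = x * (a *: y).
Proof.
elim/presW: x => s; elim/presW: y => t.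
rewrite /*%R /= /GRing.scale /= !presE; apply/clsP.
apply: congr_trans (congr_mulA _ _ _) _.
apply: congr_trans (congr_sym (congr_mulA _ _ _)).
exact: congr_Mul (congr_CstC _ _) (congr_refl _).
Qed.

Definition cst (a : R) : presented := cls (Cst a).

Lemma cst_zmod_morphism : zmod_morphism cst.
Proof.
move=> a b; apply: (addIr (cst b)); rewrite subrK /+%R /= pres_addE; apply/clsP.
by apply: congr_trans (congr_sym (congr_CstD _ _)) _; rewrite subrK; exact: congr_refl.
Qed.

Lemma cst_monoid_morphism : monoid_morphism cst.
Proof.
by split=> // a b; rewrite /*%R /= pres_mulE; apply/clsP; exact: congr_CstM.
Qed.

HB.instance Definition _ :=
  GRing.isZmodMorphism.Build R presented cst cst_zmod_morphism.
HB.instance Definition _ :=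
  GRing.isMonoidMorphism.Build R presented cst cst_monoid_morphism.

Lemma cst_scale (a : R) (x : presented) : cst a * x = a *: x.
Proof.
elim/presW: x => t; rewrite /*%R /= /GRing.scale /= !presE.
by apply/clsP; exact: congr_refl.
Qed.

Lemma cst_central (a : R) (x : presented) : cst a * x = x * cst a.
Proof.
elim/presW: x => t; rewrite /*%R /= !presE; apply/clsP; exact: congr_CstC.
Qed.

Definition gen (g : G) : presented := cls (Gen g).

Definition pres_homog (deg : G -> nat) : nat -> presented -> Prop :=
  homog cst (fun k a => exists2 g, a = gen g & k = deg g).

End Presentation.

(** * Exterior algebra: T(V) / (v * v | v \in V), V free on [J] *)

Section Exterior.
Variables (R : comPzRingType) (J : finType).

Inductive ext_rel : term R J -> term R J -> Prop :=
| ext_square (c : J -> R) :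
    let v := \big[Add/Cst 0]_j Mul (Cst (c j)) (Gen j) in
    ext_rel (Mul v v) (Cst 0).

Definition exterior : Type := presented ext_rel.

HB.instance Definition _ := GRing.PzRing.on exterior.
HB.instance Definition _ := GRing.Lmodule.on exterior.

End Exterior.

(** * Tensor product of two R-algebras

    [Gen (a, b)] is the pure tensor of [a] and [b].  The product rule carries
    no Koszul sign: it is used below only with a left factor in which every
    element of odd degree is zero. *)

Section Tensor.
Variables (R : comPzRingType) (A B : pzRingType).
Variables (iA : {rmorphism R -> A}) (iB : {rmorphism R -> B}).

Inductive tensor_rel : term R (A * B) -> term R (A * B) -> Prop :=
| tensor_Dl a a' b :
    tensor_rel (Gen (a + a', b)) (Add (Gen (a, b)) (Gen (a', b)))
| tensor_Dr a b b' :
    tensor_rel (Gen (a, b + b')) (Add (Gen (a, b)) (Gen (a, b')))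
| tensor_Zl r a b : tensor_rel (Gen (iA r * a, b)) (Mul (Cst r) (Gen (a, b)))
| tensor_Zr r a b : tensor_rel (Gen (a, iB r * b)) (Mul (Cst r) (Gen (a, b)))
| tensor_one : tensor_rel (Gen (1, 1)) (Cst 1)
| tensor_mul a a' b b' :
    tensor_rel (Mul (Gen (a, b)) (Gen (a', b'))) (Gen (a * a', b * b')).

Definition tensor : Type := presented tensor_rel.

HB.instance Definition _ := GRing.PzRing.on tensor.
HB.instance Definition _ := GRing.Lmodule.on tensor.

Definition tens (a : A) (b : B) : tensor := gen tensor_rel (a, b).

Definition tensor_homog (homA : nat -> A -> Prop) (homB : nat -> B -> Prop) :
    nat -> tensor -> Prop :=
  homog (cst tensor_rel) (fun k t => exists i j a b,
    [/\ homA i a, homB j b, t = tens a b & k = (i + j)%N]).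

End Tensor.

(** * The algebra W_D, for D = (d 0, ..., d (m - 1)) *)

Section WD.
Variables (R : comPzRingType) (m : nat) (d : 'I_m -> nat).

(** [GenP j], for [j : 'I_(d i)./2], is p_{2(j+1)}(D_i). *)
Inductive sigma_gen : Type :=
| GenP (i : 'I_m) of 'I_(d i)./2
| GenE of 'I_m.

(** [pterm i k] is p_{2k}(D_i), with p_0 = 1 and p_{2k} = 0 for k > d_i / 2. *)
Definition pterm (i : 'I_m) (k : nat) : term R sigma_gen :=
  if k is k'.+1 then
    if insub k' is Some j then Gen (@GenP i j) else Cst 0
  else Cst 1.

(** Plain commutativity is also graded commutativity here, since every
    generator of odd degree is zero ([sigma_odd]).
    The left-hand side of [sigma_p] is the component of degree 4k of the
    product of the total classes p(D_i). *)
Inductive sigma_rel : term R sigma_gen -> term R sigma_gen -> Prop :=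
| sigma_comm s t : sigma_rel (Mul s t) (Mul t s)
| sigma_p k : (0 < k)%N ->
    sigma_rel
      (\big[Add/Cst 0]_(c : {ffun 'I_m -> 'I_k.+1} | (\sum_i c i == k)%N)
         \big[Mul/Cst 1]_i pterm i (c i))
      (Cst 0)
| sigma_odd i : odd (d i) -> sigma_rel (Gen (GenE i)) (Cst 0)
| sigma_even i : ~~ odd (d i) ->
    sigma_rel (Mul (Gen (GenE i)) (Gen (GenE i))) (pterm i (d i)./2)
| sigma_prod : (forall i, ~~ odd (d i)) ->
    sigma_rel (\big[Mul/Cst 1]_i Gen (GenE i)) (Cst 0).

Definition Sigma : Type := presented sigma_rel.

HB.instance Definition _ := GRing.PzRing.on Sigma.
HB.instance Definition _ := GRing.Lmodule.on Sigma.

Lemma Sigma_mulC : commutative (@GRing.mul Sigma).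
Proof.
elim/presW=> s; elim/presW=> t; rewrite /*%R /= !pres_mulE; apply/clsP.
exact/congr_rel/sigma_comm.
Qed.

HB.instance Definition _ := GRing.PzRing_hasCommutativeMul.Build Sigma Sigma_mulC.

Definition pcl (i : 'I_m) (k : nat) : Sigma := cls sigma_rel (pterm i k).
Definition ptop (i : 'I_m) : Sigma := pcl i (d i)./2.
Definition ecl (i : 'I_m) : Sigma := gen sigma_rel (GenE i).

Definition sigma_deg (g : sigma_gen) : nat :=
  match g with GenP _ j => (4 * j.+1)%N | GenE i => d i end.

Definition dimN : nat := (\sum_i d i)%N.
Definition rankq : nat := (\sum_i (d i)./2)%N.
Definition rankn : nat := dimN./2.

(** The index [j : 'I_(rankn - rankq)] stands for [l = rankq + j + 1]. *)
Definition Lambda : Type := exterior R 'I_(rankn - rankq).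

HB.instance Definition _ := GRing.PzRing.on Lambda.
HB.instance Definition _ := GRing.Lmodule.on Lambda.

Definition lambda_deg (j : 'I_(rankn - rankq)) : nat :=
  let l := (rankq + j.+1)%N in
  if ~~ odd dimN && (l == rankn) then dimN.-1 else (4 * l)%N.-1.

Definition W : Type := tensor (cst sigma_rel) (cst (@ext_rel R 'I_(rankn - rankq))).

HB.instance Definition _ := GRing.PzRing.on W.
HB.instance Definition _ := GRing.Lmodule.on W.

Definition sigmaW (a : Sigma) : W := tens _ _ a (1 : Lambda).

Definition W_homog : nat -> W -> Prop :=
  tensor_homog (pres_homog (rel := sigma_rel) sigma_deg)
               (pres_homog (rel := @ext_rel R _) lambda_deg).

End WD.

(* Main.v *)
Require Import Defs.
From HB Require Import structures.
From mathcomp Require Import classical_sets.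
From mathcomp Require Import all_boot all_order all_algebra perm finmap boolp.
From mathcomp Require Import zify ring ssrcomplements mpoly.

(** Let A be the subalgebra of Sigma_D generated by the Pontryagin classes and
    q_i = d_i / 2, so that p_top(D_i) has index q_i.

    Killing p_top(D_k) in A only replaces q_k by q_k - 1 and leaves the other
    generators and relations unchanged.  Filtering A by the ideals generated by
    products of top classes therefore yields by induction a spanning set of
    A / (prod_(j in T) p_top(D_j)) indexed by the words with q_i letters i and
    first letter in T.  Take the dual family of products, in which smaller and
    larger letters exchange their roles.  The pairing of the two families is
    triangular, because the product of all the top classes vanishes, and its
    diagonal entries all equal a class of top degree up to sign; this class is
    detected by the antisymmetrisation functional on R[x_1, ..., x_q].  So the
    words index bases.

    As a module, Sigma_D is the sum over S of e_S A / (p_top(T_S)), where S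
    ranges over sets of even indices and T_S is the complement of S if all d_i
    are even, and everything otherwise.  Multiplication by e_m maps a spanning
    set of Sigma_D / (x) injectively into the resulting basis of Sigma_D, which
    gives the annihilator.  Finally W_D is a free Sigma_D-module, on the
    monomials of the exterior algebra. *)

Set Implicit Arguments.
Unset Strict Implicit.
Unset Printing Implicit Defensive.

Import GRing.Theory.

Local Open Scope ring_scope.

(** * Words and the top classes *)

Section Words.
Variables (R T : comPzRingType) (iota : {rmorphism R -> T}).
Variables (m : nat) (p : 'I_m -> nat -> T).
Implicit Types (w : seq 'I_m) (S : {set 'I_m}) (A I L : T -> Prop).

(** The ring [A] of multipliers is a parameter because spanning is proved with ideals of [subalg],
    and independence with ideals of the whole ring. *)
Definition is_ideal (A I : T -> Prop) : Prop :=
  [/\ I 0, forall x y, I x -> I y -> I (x + y)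
    & forall a x, A a -> I x -> I (a * x)].

Inductive subalg : T -> Prop :=
| subalgC r : subalg (iota r)
| subalg_gen i j : subalg (p i j)
| subalgD x y : subalg x -> subalg y -> subalg (x + y)
| subalgM x y : subalg x -> subalg y -> subalg (x * y).

Inductive span (L : T -> Prop) : T -> Prop :=
| span0 : span L 0
| spanD x y : span L x -> span L y -> span L (x + y)
| spanZ a x : L x -> span L (iota a * x).

Definition prod_part (k : nat) : T :=
  \sum_(c : {ffun 'I_m -> 'I_k.+1} | (\sum_i c i == k)%N) \prod_i p i (c i).

(** Each letter read off a word lowers the index of its top class by one, so the top classes depend
    on the remaining word. *)
Definition top (w0 : seq 'I_m) (j : 'I_m) : T := p j (count_mem j w0).

Definition head_in (S : {set 'I_m}) (w : seq 'I_m) : bool :=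
  if w is k :: _ then k \in S else true.

Fixpoint schub (w : seq 'I_m) : T :=
  if w is k :: w' then (\prod_(j : 'I_m | (k < j)%N) top w j) * schub w' else 1.

Definition schub_in (S : {set 'I_m}) (w : seq 'I_m) : T :=
  if w is k :: w' then (\prod_(j in S | (k < j)%N) top w j) * schub w' else 1.

(** This is [schub w] times its dual, in which the smaller letters replace the larger ones. It is
    the diagonal entry of the triangular pairing. *)
Fixpoint point (w : seq 'I_m) : T :=
  if w is k :: w' then (\prod_(j : 'I_m | j != k) top w j) * point w' else 1.

Lemma schub_inT w : schub_in [set: 'I_m] w = schub w.
Proof.
by case: w => //= k w; congr (_ * _); apply: eq_bigl => j; rewrite inE.
Qed.

Lemma top_perm w w0 j : perm_eq w w0 -> top w j = top w0 j.
Proof. by move=> /seq.permP e; rewrite /top e. Qed.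

Lemma perm_cons_rem k w w0 :
  perm_eq (k :: w) w0 -> (k \in w0) && perm_eq w (rem k w0).
Proof.
move=> e; have k0 : k \in w0 by rewrite -(perm_mem e) mem_head.
by rewrite k0 -(perm_cons k) (perm_trans e) // perm_to_rem.
Qed.

Lemma perm_rem_cons k w w0 :
  k \in w0 -> perm_eq w (rem k w0) -> perm_eq (k :: w) w0.
Proof.
by move=> k0 e; rewrite perm_sym (permPl (perm_to_rem k0)) perm_cons perm_sym.
Qed.

Lemma is_idealW A I : is_ideal (fun=> True) I -> is_ideal A I.
Proof. by case=> I0 ID IM; split=> // a x _; apply: IM. Qed.

Lemma subalg1 : subalg 1.
Proof. by rewrite -(rmorph1 iota); exact: subalgC. Qed.

Lemma subalg0 : subalg 0.
Proof. by rewrite -(rmorph0 iota); exact: subalgC. Qed.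

Lemma subalg_prod (J : Type) (s : seq J) (P : pred J) (F : J -> T) :
  (forall j, P j -> subalg (F j)) -> subalg (\prod_(j <- s | P j) F j).
Proof. by move=> h; apply: big_ind => //; [exact: subalg1 | exact: subalgM]. Qed.

Lemma ideal_sum A I (J : Type) (s : seq J) (P : pred J) (F : J -> T) :
  is_ideal A I -> (forall j, P j -> I (F j)) -> I (\sum_(j <- s | P j) F j).
Proof. by case=> I0 ID _ h; apply: big_ind. Qed.

Lemma idealN I x : is_ideal subalg I -> I x -> I (- x).
Proof.
case=> _ _ IM Ix; rewrite -mulN1r; apply: IM => //.
by rewrite -(rmorph1 iota) -rmorphN; exact: subalgC.
Qed.

Lemma span_mull L L' x a :
  (forall y, L y -> span L' (a * y)) -> span L x -> span L' (a * x).
Proof.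
have spZ b y : span L' y -> span L' (iota b * y).
  elim=> [|u v _ iu _ iv|c u Lu]; rewrite ?mulr0 ?mulrDr; first exact: span0.
  - exact: spanD.
  - by rewrite mulrA -rmorphM; exact: spanZ.
move=> h; elim=> [|u v _ iu _ iv|c u Lu]; rewrite ?mulr0 ?mulrDr.
- exact: span0.
- exact: spanD.
- by rewrite mulrCA; apply/spZ/h.
Qed.

(* A multi-index of weight [\sum_i q i] other than [q] exceeds [q] somewhere. *)
Lemma ideal_top I (q : 'I_m -> nat) :
  is_ideal subalg I -> (forall j s, (q j < s)%N -> I (p j s)) ->
  I (prod_part (\sum_i q i)%N) -> I (\prod_j p j (q j)).
Proof.
move=> idI Ip; set n := (\sum_i q i)%N.
have q_n j : (q j < n.+1)%N by rewrite ltnS /n (bigD1 j) //= leq_addr.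
pose c0 := [ffun j => Ordinal (q_n j)] : {ffun 'I_m -> 'I_n.+1}.
rewrite /prod_part (bigD1 c0) /=; last first.
  by apply/eqP/eq_bigr => i _; rewrite ffunE.
rewrite (eq_bigr (fun j => p j (q j))); last by move=> i _; rewrite ffunE.
set X := (X in _ + X); move=> h.
suff IX : I X.
  have [_ ID _] := idI.
  by rewrite -[X in I X](addrK X); apply: ID => //; exact: idealN.
apply: (ideal_sum _ idI) => c /andP[/eqP csum cne].
have [j qc] : exists j, (q j < c j)%N.
  apply/existsP; apply: contraT; rewrite negb_exists => /forallP h'.
  have le j : (c j <= q j)%N by rewrite leqNgt.
  case/eqP: cne; apply/ffunP => j; apply/val_inj; rewrite ffunE /=.
  apply/eqP; have := leqif_sum (fun i _ => leqif_eq (le i)) => /(_ predT).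
  rewrite /= => -[_]; rewrite csum eqxx => /esym/forallP /(_ j).
  by [].
rewrite (bigD1 j) //= mulrC; have [_ _ IM] := idI; apply: IM; last exact: Ip.
by apply: subalg_prod => i _; exact: subalg_gen.
Qed.

Hypothesis p0 : forall j, p j 0 = 1.

Definition span_set S w0 (x : T) : Prop :=
  exists w, [/\ perm_eq w w0, head_in S w & x = schub_in S w].

(** [I] contains the defining relations of the algebra of Pontryagin classes with content [w0]. *)
Definition ann_gens (I : T -> Prop) w0 : Prop :=
  (forall j s, (count_mem j w0 < s)%N -> I (p j s)) /\
  (forall k, (0 < k)%N -> I (prod_part k)).

Lemma ideal_prod_top I w0 : is_ideal subalg I -> ann_gens I w0 -> w0 != [::] ->
  I (\prod_j top w0 j).
Proof.
move=> idI [Ip Ic] w0n; apply: ideal_top => //; apply: Ic.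
have -> : (\sum_i count_mem i w0 = size w0)%N.
  by rewrite -sum1_size; under eq_bigr do rewrite -sum1_count;
     rewrite (exchange_big_dep xpredT) //= big_seq [RHS]big_seq;
     apply: eq_bigr => i _; rewrite (big_pred1 i).
by case: (w0) w0n.
Qed.

(* Modulo [top w0 k] the ideal of the content of [w0] becomes that of
   [rem k w0], with the same generators; the letters of [S] are treated in
   decreasing order. *)
Lemma span_step w0 :
  (forall k I f, k \in w0 -> is_ideal subalg I -> ann_gens I (rem k w0) ->
     subalg f -> exists s i, [/\ span (span_set setT (rem k w0)) s, I i
       & f = s + i]) ->
  forall I S f, is_ideal subalg I -> ann_gens I w0 -> subalg f ->
  exists s g i, [/\ span (span_set S w0) s, subalg g, I i
    & f = s + (\prod_(j in S) top w0 j) * g + i].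
Proof.
move=> IH I S f idI [Ip Ic] Af; have [I0 ID IM] := idI.
(* After [t] rounds the letters from [m - t] on have been treated. The next round treats the letter
   [k = m - t.+1]. *)
suff /(_ m)[s [g [i [sps Ag Ii ->]]]] t : exists s g i,
    [/\ span (span_set S w0) s, subalg g, I i
      & f = s + (\prod_(j in S | (m <= j + t)%N) top w0 j) * g + i].
  exists s, g, i; split=> //; congr (_ + _ * _ + _).
  by apply: eq_bigl => j; rewrite leq_addl andbT.
elim: t => [|t [s [g [i [sps Ag Ii def_f]]]]].
  exists 0, f, 0; split=> //; first exact: span0.
  rewrite big1 ?mul1r ?add0r ?addr0 // => j /andP[_].
  by rewrite addn0 leqNgt ltn_ord.
have [mt|tm] := leqP m t.
  exists s, g, i; split=> //; rewrite def_f; congr (_ + _ * _ + _).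
  apply: eq_bigl => j; rewrite (leq_trans mt) ?leq_addl //.
  by rewrite (leq_trans mt) // addnS leqW // leq_addl.
pose k := rev_ord (Ordinal tm).
have kv : k = (m - t.+1)%N :> nat by [].
have kE j : (m <= j + t)%N = (k < j)%N by lia.
have kE1 j : (m <= j + t.+1)%N = (k <= j)%N by lia.
have prodE : \prod_(j in S | (m <= j + t.+1)%N) top w0 j =
    (if k \in S then top w0 k else 1) * \prod_(j in S | (m <= j + t)%N) top w0 j.
  case: ifP => kS; last first.
    rewrite mul1r; apply: eq_bigl => j; rewrite kE kE1 leq_eqVlt.
    by case: eqP => // /val_inj <-; rewrite kS.
  rewrite (bigD1 k) /=; last by rewrite kS kE1 leqnn.
  congr (_ * _); apply: eq_bigl => j; rewrite kE kE1 leq_eqVlt -andbA.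
  rewrite -(inj_eq val_inj) /= eq_sym.
  by case: eqP => [->|]; rewrite ?ltnn ?andbT.
have triv : (if k \in S then top w0 k else 1) = 1 -> exists s g i,
    [/\ span (span_set S w0) s, subalg g, I i
      & f = s + (\prod_(j in S | (m <= j + t.+1)%N) top w0 j) * g + i].
  by move=> e; exists s, g, i; rewrite prodE e mul1r.
case: (boolP (k \in S)) prodE triv => kS prodE triv; last exact: triv.
have [k0|k0] := boolP (k \in w0); last first.
  (* The top class of a letter absent from [w0] is [p k 0 = 1], so nothing is divided out. *)
  by apply: triv; rewrite /top (count_memPn _) //.
pose h := \prod_(j in S | (m <= j + t)%N) top w0 j.
have Ah : subalg h by apply: subalg_prod => j _; exact: subalg_gen.
pose I' x := exists i a, [/\ I i, subalg a & x = i + top w0 k * a].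
have idI' : is_ideal subalg I'.
  split.
  - by exists 0, 0; rewrite mulr0 addr0; split=> //; exact: subalg0.
  - move=> _ _ [i1 [a1 [I1 A1 ->]]] [i2 [a2 [I2 A2 ->]]].
    exists (i1 + i2), (a1 + a2); split; [exact: ID | exact: subalgD |].
    by rewrite mulrDr addrACA.
  - move=> b _ Ab [i1 [a1 [I1 A1 ->]]]; exists (b * i1), (b * a1).
    by split; [exact: IM | exact: subalgM | rewrite mulrDr mulrCA].
have II' x : I x -> I' x.
  by move=> Ix; exists x, 0; rewrite mulr0 addr0; split=> //; exact: subalg0.
have annI' : ann_gens I' (rem k w0).
  split=> [j u|u /Ic]; last exact: II'.
  rewrite count_rem k0 /=; have [<-|jk] := eqVneq k j; last first.
    by rewrite subn0 => /Ip; apply: II'.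
  have [<- _|ne lt] := eqVneq (count_mem k w0) u.
    by exists 0, 1; rewrite mulr1 add0r; split=> //; exact: subalg1.
  by apply/II'/Ip; rewrite ltn_neqAle ne; move: lt; rewrite subn1; case: count.
have [s' [_ [sps' [i1 [a1 [I1 A1 ->]]] def_g]]] := IH k I' g k0 idI' annI' Ag.
(* The factor [g] has been expanded modulo [I']. Multiplication by [h] turns each word [w] of this
   expansion into [k :: w], and the part divisible by [top w0 k] extends the product [h]. *)
exists (s + h * s'), a1, (i + h * i1); split=> //.
- apply: spanD => //; apply: span_mull sps' => _ [w [eqw _ ->]].
  rewrite schub_inT -[X in span _ X]mul1r -(rmorph1 iota); apply: spanZ.
  have eqkw := perm_rem_cons k0 eqw.
  exists (k :: w); split=> //=; congr (_ * _); apply: eq_big => j.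
    by rewrite kE.
  by move=> _; exact/esym/top_perm.
- by apply: ID => //; exact: IM.
- by rewrite def_f def_g prodE -/h; ring.
Qed.

(** With all letters split off, the remainder in [span_step] is a multiple of the product of all top
    classes, which lies in [I]. For the empty content every class of positive index lies in [I], so
    only scalars remain. *)
Lemma span_schub w0 I f : is_ideal subalg I -> ann_gens I w0 -> subalg f ->
  exists s i, [/\ span (span_set setT w0) s, I i & f = s + i].
Proof.
move: {2}(size w0) (erefl (size w0)) => n.
elim: n w0 I f => [|n IHn] w0 I f szw idI annI Af.
  have w0E := size0nil szw; have [I0 ID IM] := idI; have [Ip _] := annI.
  suff [r [i [Ii ->]]] : exists r i, I i /\ f = iota r + i.
    exists (iota r * 1), i; rewrite mulr1; split=> //.
    by rewrite -[iota r]mulr1; apply: spanZ; exists [::]; rewrite w0E.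
  elim: Af => [r|j [|u]|x y Ax [r1 [i1 [I1 ->]]] Ay [r2 [i2 [I2 ->]]]
              |x y Ax [r1 [i1 [I1 def_x]]] Ay [r2 [i2 [I2 def_y]]]].
  - by exists r, 0; rewrite addr0.
  - by exists 1, 0; rewrite p0 rmorph1 addr0.
  - by exists 0, (p j u.+1); rewrite rmorph0 add0r; split=> //; apply: Ip;
       rewrite w0E.
  - by exists (r1 + r2), (i1 + i2); split; [exact: ID | rewrite rmorphD; ring].
  - exists (r1 * r2), (iota r1 * i2 + y * i1); split.
      by apply: ID; apply: IM => //; exact: subalgC.
    by rewrite def_x def_y rmorphM; ring.
have w0n : w0 != [::] by case: (w0) szw.
have step k I' f' : k \in w0 -> is_ideal subalg I' ->
    ann_gens I' (rem k w0) -> subalg f' ->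
    exists s i, [/\ span (span_set setT (rem k w0)) s, I' i & f' = s + i].
  by move=> k0; apply: IHn; rewrite size_rem // szw.
have [s [g [i [sps Ag Ii ->]]]] := span_step step setT idI annI Af.
exists s, ((\prod_(j in setT) top w0 j) * g + i); split=> //; last by rewrite addrA.
have [I0 ID IM] := idI; apply: ID => //; rewrite mulrC; apply: IM => //.
have -> : \prod_(j in setT) top w0 j = \prod_j top w0 j.
  by apply: eq_bigl => j; rewrite inE.
exact: ideal_prod_top.
Qed.

Lemma permutations_head k w0 (F : seq 'I_m -> T) : k \in w0 ->
  \sum_(w <- permutations w0) F w =
  \sum_(w <- permutations (rem k w0)) F (k :: w) +
  \sum_(w <- permutations w0 | ohead w != Some k) F w.
Proof.
move=> k0; rewrite (bigID (fun w => ohead w == Some k)); congr (_ + _).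
rewrite -big_filter -(big_map (cons k) predT).
apply/perm_big/uniq_perm.
- exact/filter_uniq/permutations_uniq.
- by rewrite map_inj_uniq ?permutations_uniq // => u v [].
move=> w; rewrite mem_filter mem_permutations; apply/andP/mapP.
  case: w => [[//]|l w [/eqP[->]] /perm_cons_rem /andP[_ e]].
  by exists w; rewrite // mem_permutations.
case=> w'; rewrite mem_permutations => e ->; split=> //=.
exact: perm_rem_cons.
Qed.

Lemma point_perm k w w0 : perm_eq (k :: w) w0 ->
  point (k :: w) = (\prod_(j : 'I_m | j != k) top w0 j) * point w.
Proof. by move=> e /=; congr (_ * _); apply: eq_bigr => j _; exact: top_perm. Qed.

Lemma schub_perm S k w w0 : perm_eq (k :: w) w0 ->
  schub_in S (k :: w) = (\prod_(j in S | (k < j)%N) top w0 j) * schub w.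
Proof. by move=> e /=; congr (_ * _); apply: eq_bigr => j _; exact: top_perm. Qed.

(* Multiplying by [\prod_(j in S | j < k) top w0 j] kills the words whose first
   letter is smaller than [k]. *)
Lemma schub_free w0 I h S (c : seq 'I_m -> R) : is_ideal (fun=> True) I ->
  (forall j s, (count_mem j w0 < s)%N -> I (h * p j s)) ->
  (forall k, (0 < k)%N -> I (prod_part k)) ->
  (forall w a, perm_eq w w0 -> I (iota a * (h * point w)) -> a = 0) ->
  I (h * (\prod_(j | j \notin S) top w0 j) *
     \sum_(w <- permutations w0 | head_in S w) iota (c w) * schub_in S w) ->
  forall w, perm_eq w w0 -> head_in S w -> c w = 0.
Proof.
move=> idI; have [I0 ID IM] := idI.
have IN x : I x -> I (- x) by exact: (idealN (is_idealW _ idI)).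
move: {2}(size w0) (erefl (size w0)) => n.
elim: n w0 h S c => [|n IHn] w0 h S c szw Ih Ic ndeg.
  move: ndeg Ih; rewrite (size0nil szw) {w0 szw} => ndeg _ Isum w.
  move=> /perm_nilP-> _; apply: (ndeg [::]) => //; move: Isum.
  rewrite big1 => [|j _]; last by rewrite /top /= p0.
  by rewrite big_cons big_nil /= !mulr1 addr0 mulrC.
move=> Isum [|k w] /[dup] ekw /perm_size; rewrite ?szw //= => _ kS.
have [k0 ew] := andP (perm_cons_rem ekw).
(* The coefficients are treated by decreasing first letter: [IHt] covers the letters larger than
   [k]. *)
move: {2}(m - k)%N (leqnn (m - k)) => t; elim: t k w ekw kS k0 ew => [|t IHt].
  by move=> k; rewrite leqn0 subn_eq0 leqNgt ltn_ord.
move=> k w ekw kS k0 ew kt.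
have bigger l w' : perm_eq (l :: w') w0 -> l \in S -> (k < l)%N ->
    c (l :: w') = 0.
  move=> e lS kl; have [l0 e'] := andP (perm_cons_rem e).
  by apply: IHt => //; lia.
(* The ideal quotient of [I] by [h] contains the relations of content [w0], hence the product of all
   top classes. *)
have Itop : I (h * \prod_j top w0 j).
  have : is_ideal subalg (fun x => I (h * x)).
    split=> [|x y Ix Iy|a x _ Ix]; rewrite ?mulr0 ?mulrDr //; first exact: ID.
    by rewrite mulrCA; exact: IM.
  move/ideal_prod_top; apply; last by case: (w0) szw.
  by split=> // u u0; apply: IM => //; exact: Ic.
pose P := \prod_(j in S | (j < k)%N) top w0 j.
pose h' := h * \prod_(j : 'I_m | j != k) top w0 j.
have allE : h' * top w0 k = h * \prod_j top w0 j.
  by rewrite /h' [in RHS](bigD1 k) //= [top _ _ * _]mulrC mulrA.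
(* By [allE] and [Itop], multiplication by [h'] sends [top w0 k] into [I], so the shorter words
   satisfy the relations of content [rem k w0]. *)
apply: (IHn (rem k w0) h' setT (fun w => c (k :: w))) => //.
- by rewrite size_rem // szw.
- move=> j s; rewrite count_rem k0 /=; have [<-|jk] := eqVneq k j; last first.
    rewrite subn0 => js; rewrite /h' mulrAC mulrC; apply: IM => //; exact: Ih.
  have [<- _|ne] := eqVneq (count_mem k w0) s; first by rewrite allE.
  move=> lt; rewrite /h' mulrAC mulrC; apply: IM => //; apply: Ih.
  by rewrite ltn_neqAle ne; move: lt; rewrite subn1; case: count.
- move=> w' a e; rewrite -mulrA -(point_perm (perm_rem_cons k0 e)) => /ndeg.
  by apply; exact: perm_rem_cons.
- rewrite big1 ?mulr1 => [|j]; last by rewrite inE.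
  move: Isum => /(IM P _ Logic.I); rewrite [\sum_(_ <- _ | _) _]big_mkcond /=.
  rewrite (permutations_head _ k0) /= kS !mulrDr.
  set X := (X in _ + X); set Y := (Y in Y + _); move=> IYX.
  (* [X] collects the words whose first letter is not [k]. The remaining sum [Y] is the one over the
     shorter words, because [P], the classes outside [S] and the first factor of [k :: w] make up
     all letters other than [k]. *)
  suff IX : I X.
    have : I Y by rewrite -[Y](addrK X); apply: ID => //; exact: IN.
    rewrite /Y; congr (I _).
    have ne_k : \prod_(j : 'I_m | j != k) top w0 j =
        (\prod_(j | j \notin S) top w0 j) *
        (P * \prod_(j in S | (k < j)%N) top w0 j).
      rewrite (bigID (mem S)) /= mulrC; congr (_ * _).
        by apply: eq_bigl => j; case: eqP => // ->; rewrite kS.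
      rewrite (bigID (fun j : 'I_m => (j < k)%N)) /=.
      by congr (_ * _); apply: eq_bigl => j; rewrite -(inj_eq val_inj) /=;
        case: ltngtP; rewrite ?andbF ?andbT.
    have -> : h' = P * (h * \prod_(j | j \notin S) top w0 j) *
                  \prod_(j in S | (k < j)%N) top w0 j.
      by rewrite /h' ne_k; ring.
    rewrite mulrA -[RHS]mulrA; congr (_ * _).
    have hT w' : head_in setT w' = true by case: w' => //= *; rewrite inE.
    rewrite [in RHS](eq_bigl _ _ hT) mulr_sumr big_seq [RHS]big_seq.
    apply: eq_bigr => w'; rewrite mem_permutations => e.
    rewrite schub_inT mulrCA; congr (_ * (_ * _)).
    by apply: eq_bigr => j _; apply: top_perm; exact: perm_rem_cons.
  rewrite /X -big_mkcondr /= mulr_sumr mulr_sumr big_seq_cond.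
  apply: (ideal_sum _ idI) => w'; rewrite mem_permutations.
  case: w' => [|l w'] /and3P[e' lk lS].
    by move/perm_size: e'; rewrite szw.
  have lk' : l != k by apply: contra lk => /eqP->.
  rewrite (schub_perm _ e').
  case: (ltngtP l k) => [lt|gt|/val_inj eq]; last by rewrite eq eqxx in lk'.
    have -> : \prod_(j in S | (l < j)%N) top w0 j =
        \prod_(j in S | (l < j)%N && (j < k)%N) top w0 j *
        \prod_(j in S | (k <= j)%N) top w0 j.
      rewrite (bigID (fun j : 'I_m => (j < k)%N)) /=; congr (_ * _).
        by apply: eq_bigl => j; rewrite andbA.
      apply: eq_bigl => j; rewrite -leqNgt -andbA; congr (_ && _).
      by apply/andP/idP => [[]//|kj]; rewrite (leq_trans lt kj).
    set U := \prod_(j in S | _ && _) _; set V := \prod_(j in S | _) _.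
    (* For [l < k] the classes in [P], in [V] and outside [S] run through all letters, so the term
       lies in [I] by [Itop]. *)
    have allE2 : h * (\prod_(j | j \notin S) top w0 j) * (P * V) =
        h * \prod_j top w0 j.
      rewrite -mulrA; congr (h * _); rewrite [RHS](bigID (mem S)) /= mulrC.
      congr (_ * _); rewrite (bigID (fun j : 'I_m => (j < k)%N)) /=; congr (_ * _).
      by apply: eq_bigl => j; rewrite -leqNgt.
    rewrite (_ : _ * _ = iota (c (l :: w')) * U * schub w' *
       (h * (\prod_(j | j \notin S) top w0 j) * (P * V))); last by ring.
    by rewrite allE2; exact: IM.
  by rewrite (bigger l w') // rmorph0 !(mul0r, mulr0).
- by case: (w) => //= *; rewrite inE.
Qed.

End Words.

(** * The antisymmetrisation functional *)

Lemma coef_prod_comp (K : comNzRingType) (m : nat) (P : 'I_m -> {poly K}) k :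
  (\prod_i P i)`_k =
  \sum_(c : {ffun 'I_m -> 'I_k.+1} | (\sum_i c i == k)%N) \prod_i (P i)`_(c i).
Proof.
(* Truncation at degree [k] gives all factors the same finite range of exponents, so that the
   product can be expanded over functions. *)
have takeP (I : Type) (s : seq I) (Q : I -> {poly K}) j : (j <= k)%N ->
    (\prod_(i <- s) Q i)`_j = (\prod_(i <- s) take_poly k.+1 (Q i))`_j.
  elim: s j => [|i s IH] j jk; first by rewrite !big_nil.
  rewrite !big_cons !coefM; apply: eq_bigr => l _.
  have lj : (l <= j)%N by rewrite -ltnS.
  by rewrite coef_take_poly ltnS (leq_trans lj) // IH // (leq_trans _ jk) ?leq_subr.
rewrite takeP //.
under eq_bigr do rewrite /take_poly poly_def.
rewrite bigA_distr_bigA coef_sum [RHS]big_mkcond; apply: eq_bigr => c _.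
by rewrite scaler_prod prodrXr coefZ coefXn eq_sym; case: eqP; rewrite ?mulr1 ?mulr0.
Qed.

Lemma coef_linear_prod (K : comNzRingType) (I : Type) (r : seq I) (c : I -> K) j :
  (size r <= j)%N ->
  (\prod_(s <- r) (1 + (c s)%:P * 'X))`_j =
  if j == size r then \prod_(s <- r) c s else 0.
Proof.
elim: r j => [|s r IH] j /=; first by rewrite !big_nil coef1; case: j.
case: j => // j; rewrite ltnS !big_cons => rj.
rewrite mulrDl mul1r coefD mulrAC coefMX /= coefCM !IH // ?leqW // eqSS.
by rewrite gtn_eqF ?ltnS // add0r; case: eqP; rewrite ?mulr0.
Qed.

Section Alternant.
Variables (R : comNzRingType).

Definition perm_mnm n (s : 'S_n) : 'X_{1..n} := [multinom (s i : nat) | i < n].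

(* Up to sign, the coefficient of the lowest Vandermonde monomial in the
   antisymmetrisation of [g]. *)
Definition alt n (g : {mpoly R[n]}) : R :=
  \sum_(s : 'S_n) (-1) ^+ s * g@_(perm_mnm s).

Lemma alt_sum n (I : Type) (r : seq I) (P : pred I) (F : I -> {mpoly R[n]}) :
  alt (\sum_(i <- r | P i) F i) = \sum_(i <- r | P i) alt (F i).
Proof.
rewrite exchange_big; apply: eq_bigr => s _.
by rewrite raddf_sum mulr_sumr.
Qed.

Lemma altD n (f g : {mpoly R[n]}) : alt (f + g) = alt f + alt g.
Proof.
by rewrite /alt -big_split; apply: eq_bigr => s _; rewrite mcoeffD mulrDr.
Qed.

Lemma alt0 n : alt (0 : {mpoly R[n]}) = 0.
Proof. by rewrite /alt big1 // => s _; rewrite mcoeff0 mulr0. Qed.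

Lemma altZ n a (g : {mpoly R[n]}) : alt (a *: g) = a * alt g.
Proof. by rewrite mulr_sumr; apply: eq_bigr => s _; rewrite mcoeffZ mulrCA. Qed.

(** Two linear functionals that agree on monomials are equal. Plain functions are allowed, so that
    composites need no declared linear structure. *)
Lemma mpoly_scalar_ext n (f g : {mpoly R[n]} -> R) :
  (forall (I : Type) (r : seq I) (F : I -> {mpoly R[n]}),
     f (\sum_(i <- r) F i) = \sum_(i <- r) f (F i)) ->
  (forall (I : Type) (r : seq I) (F : I -> {mpoly R[n]}),
     g (\sum_(i <- r) F i) = \sum_(i <- r) g (F i)) ->
  (forall a x, f (a *: x) = a * f x) -> (forall a x, g (a *: x) = a * g x) ->
  (forall a, f 'X_[a] = g 'X_[a]) -> forall x, f x = g x.
Proof.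
move=> fs gs fZ gZ fg x; rewrite (mpolyE x) fs gs.
by apply: eq_bigr => a _; rewrite fZ gZ fg.
Qed.

(** The coefficient of ['X_[a]] at [perm_mnm s] is a product of indicators of [a i = s i], so the
    sum is a Leibniz expansion. *)
Lemma altX n (a : 'X_{1..n}) :
  alt 'X_[a] = \det (\matrix_(i, j) (a i == j :> nat)%:R).
Proof.
apply: eq_bigr => s _; congr (_ * _); rewrite mcoeffX.
under eq_bigr do rewrite mxE; rewrite -natr_prod; congr _%:R.
have [->|ne] := eqVneq.
  by rewrite big1 // => i _; rewrite mnmE eqxx.
have /existsP[i ai] : [exists i, a i != s i].
  apply: contraR ne; rewrite negb_exists => /forallP h; apply/eqP/mnmP => i.
  by rewrite mnmE; apply/eqP; move: (h i); rewrite negbK.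
by rewrite (bigD1 i) //= (negbTE ai).
Qed.

(** Let [j] be the least element of [J]. If [j = 0], that column vanishes. Otherwise column [j - 1]
    is unshifted and equals column [j]. *)
Lemma det_shift0 n (a : 'I_n -> nat) (J : {set 'I_n}) : J != set0 ->
  \det (\matrix_(i, j) (a i + (j \in J) == j :> nat)%:R) = 0 :> R.
Proof.
case/set0Pn => j0 j0J.
have [j jJ jmin] :=
  @arg_minnP _ j0 (fun j => j \in J) (fun j : 'I_n => j : nat) j0J.
rewrite -det_tr; case: (posnP j) => [j_0|j_gt0].
  rewrite (expand_det_row _ j) big1 // => i _.
  by rewrite !mxE jJ j_0 (_ : (_ == _) = false) ?mul0r //; lia.
have j1 : (j.-1 < n)%N by rewrite (leq_ltn_trans (leq_pred _) (ltn_ord j)).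
apply: (@determinant_alternate _ _ _ j (Ordinal j1)).
  by rewrite -(inj_eq val_inj) /=; lia.
move=> i; rewrite !mxE jJ; have -> : Ordinal j1 \in J = false.
  by apply/negP => /jmin /=; lia.
by congr _%:R; rewrite /=; lia.
Qed.

(** The elementary symmetric polynomial, written as a coefficient of a product so that it factors
    along blocks of variables. *)
Definition esymx n k : {mpoly R[n]} :=
  (\prod_(s < n) (1 + ('X_s)%:P * 'X))`_k.

Lemma esymxE n k :
  esymx n k = \sum_(J : {set 'I_n} | #|J| == k) \prod_(s in J) 'X_s.
Proof.
rewrite /esymx; under eq_bigr do rewrite addrC.
rewrite bigA_distr coef_sum [RHS]big_mkcond; apply: eq_bigr => J _.
rewrite -big_mkcond big_split /= prodr_const -rmorph_prod coefCM coefXn eq_sym.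
by case: eqP; rewrite ?mulr1 ?mulr0.
Qed.

Lemma alt_esymx n k (g : {mpoly R[n]}) : (0 < k)%N -> alt (esymx n k * g) = 0.
Proof.
move=> k0; apply: (mpoly_scalar_ext (f := fun g => alt (esymx n k * g)) (g := fun=> 0))
  => [I r F|I r F|a x|a x|a] /=.
- by rewrite mulr_sumr alt_sum.
- by rewrite big1.
- by rewrite -scalerAr altZ.
- by rewrite mulr0.
rewrite esymxE mulr_suml alt_sum.
pose G (s : 'S_n) (J : {set 'I_n}) : R :=
  (-1) ^+ s * \prod_i (a i + (s i \in J) == s i :> nat)%:R.
(* Replacing [J] by its image under [s] moves the shift from the rows to the columns, where
   [det_shift0] applies to each [J] separately. *)
transitivity (\sum_(J : {set 'I_n} | #|J| == k) \sum_(s : 'S_n) G s (s @: J)).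
  apply: eq_bigr => J _; rewrite mprodXE -mpolyXD altX.
  apply: eq_bigr => s _; congr (_ * _); apply: eq_bigr => i _.
  rewrite mxE mnmDE mnm_sumE mem_imset; last exact: perm_inj.
  rewrite addnC (_ : (\sum_(j in J) _ = (i \in J))%N) //.
  under eq_bigr do rewrite mnm1E.
  have [iJ|iJ] := boolP (i \in J).
    by rewrite (bigD1 i) //= eqxx big1 // => j /andP[_ /negPf->].
  by rewrite big1 // => j jJ; apply/eqP; rewrite eqb0; apply: contra iJ => /eqP<-.
rewrite exchange_big /=.
transitivity (\sum_(s : 'S_n) \sum_(J : {set 'I_n} | #|J| == k) G s J).
  apply: eq_bigr => s _.
  rewrite [RHS](reindex_inj (imset_inj (@perm_inj _ s))) /=.
  by apply: eq_bigl => J; rewrite card_imset //; exact: perm_inj.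
rewrite exchange_big big1 // => J /eqP Jk.
have J0 : J != set0 by rewrite -card_gt0 Jk.
rewrite -[RHS](det_shift0 a J0); apply: eq_bigr => s _; congr (_ * _).
by apply: eq_bigr => i _; rewrite mxE.
Qed.

Definition drop_val n (r s : 'I_n.+1) : {mpoly R[n]} :=
  if unlift r s is Some s' then 'X_s' else 0.

Lemma drop_val_self n (r : 'I_n.+1) : drop_val r r = 0.
Proof. by rewrite /drop_val unlift_none. Qed.

Lemma drop_val_lift n (r : 'I_n.+1) s : drop_val r (lift r s) = 'X_s.
Proof. by rewrite /drop_val liftK. Qed.

(** Sets the variable [r] to zero and renumbers the others. *)
Definition drop_var n (r : 'I_n.+1) : {mpoly R[n.+1]} -> {mpoly R[n]} :=
  mmap (@mpolyC n R) (drop_val r).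

HB.instance Definition _ n (r : 'I_n.+1) :=
  GRing.RMorphism.on (drop_var r).

Lemma drop_varX n (r : 'I_n.+1) s : drop_var r 'X_(lift r s) = 'X_s.
Proof. by rewrite /drop_var mmapX mmap1U drop_val_lift. Qed.

(** On monomials, only row [r] can have exponent 0, so the determinant of [altX] is expanded along
    column 0. The cofactor is the determinant for the monomial without [r]. *)
Lemma alt_drop n (r : 'I_n.+1) (g : {mpoly R[n.+1]}) :
  alt ((\prod_(s | s != r) 'X_s) * g) = (-1) ^+ r * alt (drop_var r g).
Proof.
apply: (mpoly_scalar_ext (f := fun g => alt (_ * g))
                (g := fun g => (-1) ^+ r * alt (drop_var r g)))
  => [I l F|I l F|a x|a x|a] /=.
- by rewrite mulr_sumr alt_sum.
- by rewrite /drop_var raddf_sum alt_sum mulr_sumr.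
- by rewrite -scalerAr altZ.
- by rewrite /drop_var mmapZ mul_mpolyC altZ mulrCA.
rewrite mprodXE -mpolyXD altX.
have aE i : ((\sum_(s | s != r) U_(s)) + a)%MM i = ((i != r) + a i)%N.
  rewrite mnmDE mnm_sumE; congr (_ + _)%N; under eq_bigr do rewrite mnm1E.
  have [ir|ir] := boolP (i != r).
    by rewrite (bigD1 i) //= eqxx big1 // => j /andP[_ /negPf->].
  by rewrite big1 // => j jr; apply/eqP; rewrite eqb0; apply: contra ir => /eqP<-.
rewrite (expand_det_col _ ord0) (bigD1 r) //= [X in _ + X]big1 ?addr0; last first.
  by move=> i ir; rewrite mxE aE ir mul0r.
rewrite mxE aE eqxx /= add0n /drop_var mmapX /mmap1.
rewrite [\prod_(i < n.+1) _](bigD1_ord r) //=.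
rewrite drop_val_self; have [->|a0] := eqVneq (a r) 0%N; last first.
  by rewrite expr0n (negbTE a0) !mul0r alt0 mulr0.
rewrite expr0 !mul1r /cofactor addn0; congr (_ * _).
under [X in alt X]eq_bigr do rewrite drop_val_lift.
rewrite (_ : \prod_(i < n) _ = 'X_[[multinom a (lift r i) | i < n]]); last first.
  by rewrite mpolyXE_id; apply: eq_bigr => i _; rewrite mnmE.
rewrite altX; congr (\det _); apply/matrixP => i j.
by rewrite !mxE aE mnmE [lift r i == r]eq_sym neq_lift lift0 add1n eqSS.
Qed.

(** * Elementary symmetric polynomials in blocks of variables *)

Section Blocks.
Variable m : nat.

Definition block_poly n (b : 'I_n -> 'I_m) (i : 'I_m) : {poly {mpoly R[n]}} :=
  \prod_(s | b s == i) (1 + ('X_s)%:P * 'X).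

Definition block_esym n (b : 'I_n -> 'I_m) (i : 'I_m) (j : nat) : {mpoly R[n]} :=
  (block_poly b i)`_j.

Lemma comp_block n (b : 'I_n -> 'I_m) k : prod_part (block_esym b) k = esymx n k.
Proof.
rewrite /prod_part -coef_prod_comp /esymx; congr ((polyseq _)`_k).
by rewrite [RHS](partition_big b xpredT).
Qed.

Lemma block_esym0 n (b : 'I_n -> 'I_m) i : block_esym b i 0 = 1.
Proof.
rewrite /block_esym -horner_coef0 horner_prod big1 // => s _.
by rewrite hornerD hornerM hornerX mulr0 addr0 hornerC.
Qed.

Definition block_size n (b : 'I_n -> 'I_m) (i : 'I_m) : nat := \sum_s (b s == i).

Lemma block_esym_ge n (b : 'I_n -> 'I_m) i j : (block_size b i <= j)%N ->
  block_esym b i j =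
  if j == block_size b i then \prod_(s | b s == i) 'X_s else 0.
Proof.
have -> : block_size b i = size [seq s <- index_enum 'I_n | b s == i].
  rewrite size_filter -sum1_count [RHS]big_mkcond.
  by apply: eq_bigr => s _; case: eqP.
move=> le; rewrite /block_esym /block_poly -big_filter coef_linear_prod //.
by rewrite big_filter.
Qed.

Lemma drop_block n (b : 'I_n.+1 -> 'I_m) r i j :
  drop_var r (block_esym b i j) = block_esym (b \o lift r) i j.
Proof.
rewrite /block_esym -coef_map; congr ((polyseq _)`_j); rewrite rmorph_prod.
rewrite (eq_bigr (fun s => 1 + (drop_val r s)%:P * 'X)) => [|s _]; last first.
  rewrite rmorphD rmorph1 rmorphM /= map_polyC map_polyX /=.
  by rewrite /drop_var mmapX mmap1U.
rewrite /block_poly big_mkcond [RHS]big_mkcond /= [LHS](bigD1_ord r) //=.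
rewrite drop_val_self mul0r addr0 if_same mul1r.
by apply: eq_bigr => s _; rewrite drop_val_lift.
Qed.

Lemma drop_point n (b : 'I_n.+1 -> 'I_m) r w :
  drop_var r (point (block_esym b) w) = point (block_esym (b \o lift r)) w.
Proof.
elim: w => [|k w IH] /=; first exact: rmorph1.
rewrite rmorphM rmorph_prod /= IH; congr (_ * _).
by apply: eq_bigr => j _; exact: drop_block.
Qed.

(** [alt] vanishes on polynomials symmetric in two variables. The product of the staircase monomials
    of the blocks breaks the symmetry within each block. *)
Definition stair n (b : 'I_n -> 'I_m) : {mpoly R[n]} :=
  \prod_s 'X_s ^+ (\sum_(t : 'I_n | (t < s)%N) (b t == b s))%N.

(** By induction on the word. The first factor of [point] is the product of the variables outside
    the block [k], and [stair] supplies those inside it except one, [r]. Then [alt_drop] removes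
    [r]. *)
Lemma alt_point n (b : 'I_n -> 'I_m) w :
  (forall i, count_mem i w = block_size b i) ->
  exists e, alt (stair b * point (block_esym b) w) = (-1) ^+ e.
Proof.
elim: n b w => [|n IHn] b w cnt.
  have -> : w = [::].
    by case: w cnt => // k w /(_ k); rewrite /block_size big_ord0 /= eqxx.
  exists 0%N; rewrite /stair big_ord0 mul1r expr0 /=.
  by rewrite -mpolyX0 altX det_mx00.
case: w cnt => [|k w] cnt.
  by move: (cnt (b ord0)); rewrite /block_size big_ord_recl eqxx.
have [r0 br0] : exists s, b s == k.
  apply/existsP; apply: contraT; rewrite negb_exists => /forallP nb.
  move: (cnt k); rewrite /= eqxx /block_size big1 // => s _.
  by rewrite (negPf (nb s)).
(* The least variable of the block has staircase exponent 0, and its removal lowers the exponent of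
   every other variable of the block by one. *)
have [r /eqP br rmin] :=
  @arg_minnP _ r0 (fun s => b s == k) (fun s : 'I_ _ => s : nat) br0.
pose b' := b \o lift r.
have [i|e IH] := IHn b' w.
  by move: (cnt i); rewrite /block_size (bigD1_ord r) //= br => /addnI.
exists (r + e)%N; rewrite exprD -IH.
have topE j : top (block_esym b) (k :: w) j = \prod_(s | b s == j) 'X_s.
  by rewrite /top cnt block_esym_ge // eqxx.
have -> : point (block_esym b) (k :: w) =
    (\prod_(s | b s != k) 'X_s) * point (block_esym b) w.
  rewrite /=; congr (_ * _).
  transitivity (\prod_(j | j != k) \prod_(s | b s == j) ('X_s : {mpoly R[n.+1]})).
    by apply: eq_bigr => j _; exact: topE.
  rewrite [RHS](partition_big b (fun j => j != k)) //.
  apply: eq_bigr => j jk; apply: eq_bigl => s.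
  by case: eqP => [->|]; rewrite ?jk ?andbF.
have lift_ne s : lift r s != r by rewrite eq_sym neq_lift.
pose G : {mpoly R[n.+1]} := \prod_s 'X_(lift r s) ^+
  (\sum_(t : 'I_n | (t < s)%N) (b' t == b' s))%N.
have stairE : stair b * \prod_(s | b s != k) 'X_s =
    (\prod_(s | s != r) 'X_s) * G.
  rewrite /stair [\prod_(s | b s != k) _]big_mkcond -big_split /=.
  rewrite [\prod_(s | s != r) _]big_mkcond [in RHS](bigD1_ord r) //= eqxx mul1r.
  rewrite -big_split /= [LHS](bigD1_ord r) //= br eqxx mulr1 big1 ?mul1r; last first.
    move=> t tr; apply/eqP; rewrite eqb0; apply: contraL tr => /rmin.
    by rewrite leqNgt.
  apply: eq_bigr => s _; rewrite lift_ne.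
  rewrite -exprS.
  set X := 'X_(lift r s).
  have -> : (if b (lift r s) != k then X else 1) = X ^+ (b (lift r s) != k).
    by case: ifP.
  rewrite -exprD; congr (_ ^+ _).
  rewrite [X in (X + _)%N]big_mkcond (bigD1_ord r) //= br.
  rewrite [in RHS]big_mkcond addnAC -[RHS]add1n; congr (_ + _)%N; last first.
    by apply: eq_bigr => t _; rewrite !ltnNge leq_bump2.
  rewrite [k == _]eq_sym; case: (eqVneq (b (lift r s)) k) => [e0|_].
    have := rmin (lift r s); rewrite e0 eqxx => /(_ isT) le.
    by rewrite (_ : (r < bump r s)%N) // ltn_neqAle le eq_sym lift_ne.
  by rewrite if_same.
rewrite mulrA stairE -mulrA alt_drop; congr (_ * alt _).
rewrite /drop_var rmorphM /= -/(drop_var r) drop_point; congr (_ * _).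
rewrite rmorph_prod; apply: eq_bigr => s _.
by rewrite rmorphXn /= drop_varX.
Qed.

End Blocks.
End Alternant.

(** * Evaluation of terms modulo an ideal, and classes of terms *)

Section Eval.
Variables (R : comPzRingType) (G : Type) (T : pzRingType).
Variables (iota : {rmorphism R -> T}) (g : G -> T).

Fixpoint ev (t : term R G) : T :=
  match t with
  | Cst r => iota r
  | Gen x => g x
  | Add s u => ev s + ev u
  | Mul s u => ev s * ev u
  end.

Lemma ev_sum (I : Type) (r : seq I) (P : pred I) (F : I -> term R G) :
  ev (\big[Add/Cst 0]_(i <- r | P i) F i) = \sum_(i <- r | P i) ev (F i).
Proof. by apply: big_morph => //=; exact: rmorph0. Qed.

Lemma ev_prod (I : Type) (r : seq I) (P : pred I) (F : I -> term R G) :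
  ev (\big[Mul/Cst 1]_(i <- r | P i) F i) = \prod_(i <- r | P i) ev (F i).
Proof. by apply: big_morph => //=; exact: rmorph1. Qed.

Hypothesis iota_central : forall r x, iota r * x = x * iota r.

Variables (rel : term R G -> term R G -> Prop) (N : T -> Prop).
Hypothesis N0 : N 0.
Hypothesis ND : forall x y, N x -> N y -> N (x + y).
Hypothesis NMl : forall a x, N x -> N (a * x).
Hypothesis NMr : forall a x, N x -> N (x * a).
Hypothesis Nrel : forall s t, rel s t -> N (ev s - ev t).

(** The two-sided ideal [N] replaces a quotient ring as the target of the evaluation. *)
Lemma ev_congr s t : congr rel s t -> N (ev s - ev t).
Proof.
have NN x : N x -> N (- x) by move=> Nx; rewrite -mulN1r; exact: NMl.
have eq0 x y : x = y -> N (x - y) by move=> ->; rewrite subrr.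
elim=> {s t} /=; try by move=> *; apply: eq0;
  rewrite ?(addrA, mulrA, mulrDl, mulrDr, rmorph0, rmorphN, rmorph1, rmorphD,
    rmorphM, mul1r, mulr1, add0r, mulN1r, addNr) // addrC.
- exact: Nrel.
- by move=> s t _ /NN; rewrite opprB.
- by move=> s t u _ Nst _ Ntu; rewrite -[ev s](subrK (ev t)) -addrA; exact: ND.
- by move=> s s' t t' _ Ns _ Nt; rewrite opprD addrACA; exact: ND.
- move=> s s' t t' _ Ns _ Nt.
  rewrite (_ : _ - _ = (ev s - ev s') * ev t + ev s' * (ev t - ev t')).
    by apply: ND; [exact: NMr | exact: NMl].
  by rewrite mulrBl mulrBr addrA subrK.
Qed.

End Eval.

Section PresentedRing.
Variables (R : comPzRingType) (G : Type) (rel : term R G -> term R G -> Prop).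

Lemma clsD s t : cls rel (Add s t) = cls rel s + cls rel t.
Proof. by rewrite /+%R /= pres_addE. Qed.

Lemma clsM s t : cls rel (Mul s t) = cls rel s * cls rel t.
Proof. by rewrite /*%R /= pres_mulE. Qed.

Lemma cls_sum (I : Type) (r : seq I) (P : pred I) (F : I -> term R G) :
  cls rel (\big[Add/Cst 0]_(i <- r | P i) F i) = \sum_(i <- r | P i) cls rel (F i).
Proof. by apply: big_morph => // s t; exact: clsD. Qed.

Lemma cls_prod (I : Type) (r : seq I) (P : pred I) (F : I -> term R G) :
  cls rel (\big[Mul/Cst 1]_(i <- r | P i) F i) = \prod_(i <- r | P i) cls rel (F i).
Proof. by apply: big_morph => // s t; exact: clsM. Qed.

End PresentedRing.

(** * Coordinates modulo the relations X_i^2 = t_i *)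

Section Theta.
Variables (K : comNzRingType) (m : nat) (t : 'I_m -> K).
Implicit Types (P S : {set 'I_m}) (a : 'X_{1..m}) (g h : {mpoly K[m]}).

Definition tau P a : K :=
  \prod_i (if odd (a i) == (i \in P) then t i ^+ (a i)./2 else 0).

(* The coefficient of [\prod_(i in P) 'X_i] once each ['X_i ^+ 2] is replaced
   by [t i]. *)
Definition theta P g : K := \sum_(a <- msupp g) g@_a * tau P a.

(** A common bound replaces the support, which varies with [g], and makes linearity visible. *)
Lemma thetaE P g k : (msize g <= k)%N ->
  theta P g = \sum_(a : 'X_{1..m < k}) g@_a * tau P a.
Proof.
move=> le; rewrite /theta (big_mksub 'X_{1..m < k}) ?msupp_uniq //=; last first.
  by move=> x /msize_mdeg_lt /leq_trans; apply.
by rewrite big_rmcond //= => j /memN_msupp_eq0 ->; rewrite mul0r.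
Qed.

Lemma theta_is_linear P : linear_for *%R (theta P).
Proof.
move=> c g h; pose k := maxn (msize (c *: g + h)) (maxn (msize g) (msize h)).
rewrite !(@thetaE P _ k) ?leq_max ?leqnn ?orbT //.
rewrite mulr_sumr -big_split; apply: eq_bigr => a _ /=.
by rewrite mcoeffD mcoeffZ mulrDl mulrA.
Qed.

HB.instance Definition _ P :=
  GRing.isLinear.Build K {mpoly K[m]} K *%R (theta P) (theta_is_linear P).

Lemma theta_sum P (I : Type) (r : seq I) (Q : pred I) (F : I -> {mpoly K[m]}) :
  theta P (\sum_(i <- r | Q i) F i) = \sum_(i <- r | Q i) theta P (F i).
Proof. exact: raddf_sum. Qed.

Lemma thetaD P g h : theta P (g + h) = theta P g + theta P h.
Proof. exact: raddfD. Qed.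

Lemma thetaB P g h : theta P (g - h) = theta P g - theta P h.
Proof. exact: raddfB. Qed.

Lemma theta0 P : theta P 0 = 0.
Proof. exact: raddf0. Qed.

Lemma thetaZ P c g : theta P (c *: g) = c * theta P g.
Proof. exact: linearZ. Qed.

Lemma thetaX P a : theta P 'X_[a] = tau P a.
Proof. by rewrite /theta msuppX big_seq1 mcoeffX eqxx mul1r. Qed.

Lemma theta_sqr P i g : theta P ('X_i * 'X_i * g) = t i * theta P g.
Proof.
apply: (mpoly_scalar_ext (f := fun g => theta P (_ * g))
          (g := fun g => t i * theta P g)) => [I r F|I r F|c x|c x|a] /=.
- by rewrite mulr_sumr theta_sum.
- by rewrite theta_sum mulr_sumr.
- by rewrite -scalerAr thetaZ.
- by rewrite thetaZ mulrCA.
rewrite -!mpolyXD !thetaX /tau (bigD1 i) //= [in RHS](bigD1 i) //= mulrA.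
congr (_ * _).
  rewrite !mnmDE !mnm1E eqxx add1n /= negbK; case: ifP; rewrite ?mulr0 //.
  by rewrite exprS.
by apply: eq_bigr => j ji; rewrite !mnmDE !mnm1E [i == j]eq_sym (negPf ji).
Qed.

Lemma theta_prodX S P : theta P (\prod_(i in S) 'X_i) = (P == S)%:R.
Proof.
rewrite mprodXE thetaX /tau.
have aE i : (\sum_(j in S) U_(j))%MM i = (i \in S) :> nat.
  rewrite mnm_sumE; under eq_bigr do rewrite mnm1E.
  have [iS|iS] := boolP (i \in S).
    by rewrite (bigD1 i) //= eqxx big1 // => j /andP[_ /negPf->].
  by rewrite big1 // => j jS; apply/eqP; rewrite eqb0; apply: contra iS => /eqP<-.
have [->|ne] := eqVneq P S.
  by rewrite big1 // => i _; rewrite aE oddb eqxx; case: (i \in S).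
have /existsP[i iPS] : [exists i, (i \in P) != (i \in S)].
  apply: contraR ne; rewrite negb_exists => /forallP h; apply/eqP/setP => i.
  by apply/eqP; move: (h i); rewrite negbK.
by rewrite (bigD1 i) //= aE oddb eq_sym (negPf iPS) mul0r.
Qed.

(** On monomials, multiplication by X_i flips the parity of the exponent and completes a square
    exactly when the exponent was odd. The factors [t i] for [i] in [P] compensate for the other
    case. This serves to verify the relation that the product of all e_i vanishes. *)
Lemma theta_all P g :
  (\prod_(i in P) t i) * theta P ((\prod_i 'X_i) * g) =
  (\prod_i t i) * theta (~: P) g.
Proof.
apply: (mpoly_scalar_ext 
    (f := fun g => (\prod_(i in P) t i) * theta P ((\prod_i 'X_i) * g))
    (g := fun g => (\prod_i t i) * theta (~: P) g)) => [I r F|I r F|c x|c x|a] /=.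
- by rewrite [_ * \sum_(i <- r) F i]mulr_sumr theta_sum mulr_sumr.
- by rewrite theta_sum mulr_sumr.
- by rewrite -scalerAr thetaZ mulrCA.
- by rewrite thetaZ mulrCA.
rewrite mprodXE -mpolyXD !thetaX [\prod_(i in P) _]big_mkcond -!big_split.
apply: eq_bigr => i _ /=; rewrite inE mnmDE.
have -> : (\sum_j U_(j))%MM i = 1%N.
  rewrite mnm_sumE (bigD1 i) //= mnm1E eqxx big1 // => j ji.
  by rewrite mnm1E (negPf ji).
rewrite add1n /= uphalf_half.
by case: (odd _); case: (i \in P); rewrite /= ?mulr0 ?mul1r // ?add0n ?exprS.
Qed.

End Theta.

(** * A basis of Sigma_D *)

Section SigmaBasis.
Variables (m : nat) (d : 'I_m -> nat).
Implicit Types (S : {set 'I_m}) (w : seq 'I_m).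

Definition all_even : bool := [forall i, ~~ odd (d i)].

Definition evens : {set 'I_m} := [set i | ~~ odd (d i)].

(* The coefficient module of [e_S] in Sigma_D is A / (ptop_T) with [T] the set
   below, where A is the subalgebra generated by the classes [pcl]. *)
Definition top_set S : {set 'I_m} := if all_even then ~: S else setT.

Definition esig (R : comPzRingType) S : Sigma R d := \prod_(i in S) ecl R d i.

Definition is_content (w0 : seq 'I_m) : Prop :=
  forall i, count_mem i w0 = (d i)./2.

Lemma pterm0 (R : comPzRingType) i : pterm R d i 0 = Cst 1.
Proof. by []. Qed.

Lemma pterm_gt (R : comPzRingType) i k : ((d i)./2 < k)%N ->
  pterm R d i k = Cst 0.
Proof. by case: k => // k le; rewrite /pterm insubF // ltnNge -ltnS le. Qed.

Section Independence.
Variables (R : comNzRingType) (w0 : seq 'I_m).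
Hypothesis w0P : is_content w0.
(** Excludes the case where all d_i are 0, in which Sigma_D is the zero ring. *)
Hypothesis nondeg : ~~ all_even || (w0 != [::]).

Let b := tnth (in_tuple w0).
Let K : comNzRingType := {mpoly R[size w0]}.
Let p := block_esym R b.
Let t i := top p w0 i.
Let T : comNzRingType := {mpoly K[m]}.
Let iota : {rmorphism R -> T} := @mpolyC m K \o @mpolyC (size w0) R.

Let gval (g : sigma_gen d) : T :=
  match g with
  | GenP i j => (p i j.+1)%:MP
  | GenE i => if odd (d i) then 0 else 'X_i
  end.

Let evS := ev iota gval.

(** The coefficient of e_P has to be tested modulo the product of the top classes in [top_set P].
    Multiplication by the other top classes turns this product into that of all top classes, which
    is null. *)
Let weight P : K := \prod_(j | j \notin top_set P) t j.

(** The ideal of the elements of [T] that the weighted functionals do not see. Evaluation of terms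
    defines a map from Sigma_D to [T] modulo [null]. *)
Let null (x : T) : Prop :=
  forall P h, alt (stair R b * (weight P * theta t P (x * h))) = 0.

Let nullK (x : K) : Prop := forall h, alt (stair R b * (h * x)) = 0.

Let nullK_ideal : is_ideal (fun=> True) nullK.
Proof.
split=> [h|x y hx hy h|a x _ hx h].
- by rewrite !mulr0 alt0.
- by rewrite !mulrDr altD hx hy addr0.
- by rewrite [h * _]mulrA hx.
Qed.

Lemma block_size_tnth i : block_size b i = count_mem i w0.
Proof.
rewrite /block_size -sum1_count (big_tnth _ _ w0) [RHS]big_mkcond.
by apply: eq_bigr => s _; rewrite /= -/b; case: eqP.
Qed.

Let p_gt i k : (count_mem i w0 < k)%N -> p i k = 0.
Proof.
by rewrite -block_size_tnth => lt; rewrite /p block_esym_ge ?gtn_eqF // ltnW.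
Qed.

Let nullK_comp k : (0 < k)%N -> nullK (prod_part p k).
Proof.
by move=> k0 h; rewrite /p comp_block [h * _]mulrC mulrCA alt_esymx.
Qed.

Let p0 i : p i 0 = 1.
Proof. exact: block_esym0. Qed.

Let ev_pterm i k : evS (pterm R d i k) = (p i k)%:MP.
Proof.
case: k => [|k]; first by rewrite pterm0 /= p0 !rmorph1.
rewrite /pterm; case: insubP => [j _ <- //|kd].
by rewrite /= !rmorph0 p_gt ?rmorph0 // w0P ltnS leqNgt.
Qed.

Let theta_scal P c (x : T) : theta t P (c%:MP * x) = c * theta t P x.
Proof. by rewrite mul_mpolyC thetaZ. Qed.

Let null_rel s u : sigma_rel s u -> null (evS s - evS u).
Proof.
case=> {s u} [s u|k k0|i di|i di|ev_d] P h.
- by rewrite /= [ev _ _ u * _]mulrC subrr mul0r theta0 !mulr0 alt0.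
- have -> : evS (\big[Add/Cst 0]_(c : {ffun 'I_m -> 'I_k.+1} | (\sum_i c i == k)%N)
         \big[Mul/Cst 1]_i pterm R d i (c i)) = (prod_part p k)%:MP.
    rewrite /evS ev_sum rmorph_sum; apply: eq_bigr => c _.
    by rewrite ev_prod rmorph_prod; apply: eq_bigr => i _; exact: ev_pterm.
  by rewrite /= !rmorph0 subr0 theta_scal [weight P * _]mulrCA
    [prod_part p k * _]mulrC nullK_comp.
- by rewrite /= di !rmorph0 subrr mul0r theta0 !mulr0 alt0.
- rewrite -/evS ev_pterm /= (negPf di) mulrBl thetaB theta_sqr theta_scal.
  by rewrite /t /top w0P subrr !mulr0 alt0.
- rewrite /evS ev_prod /= !rmorph0 subr0.
  have evT : all_even by apply/forallP.
  have -> : weight P = \prod_(i in P) t i.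
    by apply: eq_bigl => i; rewrite /top_set evT inE negbK.
  rewrite (eq_bigr (fun i => 'X_i)) => [|i _]; last by rewrite (negPf (ev_d i)).
  (* The product of all top classes appears. It lies in [nullK] since the content is nonempty. *)
  rewrite theta_all [_ * theta _ _ _]mulrC.
  have := @ideal_prod_top R K (@mpolyC (size w0) R) m p nullK w0.
  apply; [exact: is_idealW nullK_ideal | split | by move: nondeg; rewrite evT].
  - by move=> j k jk h'; rewrite p_gt // !mulr0 alt0.
  - exact: nullK_comp.
Qed.

Let null_congr s u : congr (@sigma_rel R m d) s u -> null (evS s - evS u).
Proof.
apply: ev_congr; last exact: null_rel.
- by move=> r x; rewrite mulrC.
- by move=> P h; rewrite mul0r theta0 !mulr0 alt0.
- move=> x y hx hy P h; rewrite mulrDl thetaD !mulrDr altD.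
  exact: etrans (congr2 +%R (hx P h) (hy P h)) (addr0 0).
- by move=> a x hx P h; rewrite -mulrA [a * (x * h)]mulrCA (hx P).
- by move=> a x hx P h; rewrite -mulrA (hx P).
Qed.

(** A relation and not a function, since an element of Sigma_D determines its value only modulo
    [null]. *)
Let rep (x : Sigma R d) (v : T) : Prop :=
  exists2 u, cls _ u = x & evS u = v.

Let repD x y v u : rep x v -> rep y u -> rep (x + y) (v + u).
Proof. by case=> s <- <- [s' <- <-]; exists (Add s s'); rewrite ?clsD. Qed.

Let repM x y v u : rep x v -> rep y u -> rep (x * y) (v * u).
Proof. by case=> s <- <- [s' <- <-]; exists (Mul s s'); rewrite ?clsM. Qed.

Let rep1 : rep 1 1.
Proof. by exists (Cst 1); rewrite //= !rmorph1. Qed.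

Let rep0 : rep 0 0.
Proof. by exists (Cst 0); rewrite //= !rmorph0. Qed.

Let rep_cst c : rep (cst _ c) c%:MP%:MP.
Proof. by exists (Cst c). Qed.

Let rep_sum (I : Type) (r : seq I) (P : pred I) F G :
  (forall i, rep (F i) (G i)) ->
  rep (\sum_(i <- r | P i) F i) (\sum_(i <- r | P i) G i).
Proof. by move=> h; apply: (big_ind2 rep) => // *; exact: repD. Qed.

Let rep_prod (I : Type) (r : seq I) (P : pred I) F G :
  (forall i, rep (F i) (G i)) ->
  rep (\prod_(i <- r | P i) F i) (\prod_(i <- r | P i) G i).
Proof. by move=> h; apply: (big_ind2 rep) => // *; exact: repM. Qed.

Let rep_pcl i k : rep (pcl R d i k) (p i k)%:MP.
Proof. by exists (pterm R d i k); rewrite ?ev_pterm. Qed.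

Let rep_schub w : rep (schub (pcl R d) w) (schub p w)%:MP.
Proof.
elim: w => [|k w IH] /=; first by rewrite rmorph1.
by rewrite rmorphM rmorph_prod; apply: repM => //; apply: rep_prod => i; exact: rep_pcl.
Qed.

Let rep_schub_in S w : rep (schub_in (pcl R d) S w) (schub_in p S w)%:MP.
Proof.
case: w => [|k w] /=; first by rewrite rmorph1.
rewrite rmorphM rmorph_prod; apply: repM; last exact: rep_schub.
by apply: rep_prod => i; exact: rep_pcl.
Qed.

Let rep_esig S : S \subset evens -> rep (esig R S) (\prod_(i in S) 'X_i).
Proof.
move=> /subsetP SE.
have -> : \prod_(i in S) 'X_i = \prod_(i in S) evS (Gen (GenE d i)).
  by apply: eq_bigr => i /SE; rewrite inE /= => /negPf->.
by apply: rep_prod => i; exists (Gen (GenE d i)).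
Qed.

(** [theta t S] isolates the coefficient of e_S, and [weight S] supplies the top classes outside
    [top_set S] that [schub_free] asks for. *)
Lemma sigma_free (c : {set 'I_m} -> seq 'I_m -> R) :
  \sum_(S : {set 'I_m} | S \subset evens)
    \sum_(w <- permutations w0 | head_in (top_set S) w)
       cst _ (c S w) * (esig R S * schub_in (pcl R d) (top_set S) w) = 0 ->
  forall S w, S \subset evens -> perm_eq w w0 -> head_in (top_set S) w ->
  c S w = 0.
Proof.
move=> sum0 S w SE ew hw.
pose V : T := \sum_(S : {set 'I_m} | S \subset evens)
    \sum_(w <- permutations w0 | head_in (top_set S) w)
       (c S w)%:MP%:MP * ((\prod_(i in S) 'X_i) * (schub_in p (top_set S) w)%:MP).
have nullV : null V.
  have : rep 0 V.
    rewrite -sum0 /V big_mkcond [X in rep _ X]big_mkcond.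
    apply: rep_sum => S'; case: ifP => // SE'.
    by apply: rep_sum => w'; apply: repM => //; apply: repM; [exact: rep_esig|].
  case=> u u0 <-; have /clsP/null_congr : cls (@sigma_rel R m d) u = cls _ (Cst 0).
    by rewrite u0.
  by rewrite /= !rmorph0 subr0.
apply: (schub_free (iota := @mpolyC (size w0) R) p0 nullK_ideal (h := 1)
  (S := top_set S) (w0 := w0) (c := c S)) => //.
- by move=> j s js h; rewrite p_gt // !mulr0 alt0.
(* The nondegeneracy hypothesis: the functional takes the value of a sign on [point w'], and a sign
   is invertible over any ring. *)
- move=> w' a ew' /(_ 1); rewrite mul1r mul1r mulrCA mul_mpolyC altZ.
  have [|e ->] := @alt_point R m _ b w'.
    by move=> i; rewrite (seq.permP ew') block_size_tnth.
  move=> /(congr1 ( *%R^~ ((-1) ^+ e))).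
  by rewrite -mulrA -exprMn mulrNN mulr1 expr1n mulr1 mul0r.
move=> h; have := nullV S h%:MP.
rewrite mul1r; congr (alt (_ * _) = _).
rewrite mulrCA; congr (_ * _).
rewrite [V * _]mulrC theta_scal; congr (_ * _).
have termE S' w' : theta t S ((c S' w')%:MP%:MP *
      ((\prod_(i in S') 'X_i) * (schub_in p (top_set S') w')%:MP)) =
    (S == S')%:R * ((c S' w')%:MP * schub_in p (top_set S') w').
  by rewrite theta_scal [_ * _%:MP]mulrC theta_scal theta_prodX mulrA mulrC.
have -> : theta t S V = \sum_(S' : {set 'I_m} | S' \subset evens)
    \sum_(w' <- permutations w0 | head_in (top_set S') w')
      (S == S')%:R * ((c S' w')%:MP * schub_in p (top_set S') w').
  rewrite /V theta_sum; apply: eq_bigr => S' _; rewrite theta_sum.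
  by apply: eq_bigr => w' _; exact: termE.
rewrite (bigD1 S) //= [X in _ + X]big1 ?addr0 => [|S' /andP[_ SS']].
  by apply: eq_bigr => w' _; rewrite eqxx mul1r.
by rewrite big1 // => w' _; rewrite eq_sym (negPf SS') mul0r.
Qed.

End Independence.
End SigmaBasis.

(** * Spanning sets of Sigma_D *)

Section SigmaSpan.
Variables (m : nat) (d : 'I_m -> nat) (R : comPzRingType).
Implicit Types (S U : {set 'I_m}) (w : seq 'I_m) (x y : Sigma R d).

Notation p := (pcl R d).
Notation e := (ecl R d).
Let iota : {rmorphism R -> Sigma R d} := cst (@sigma_rel R m d).

Lemma pcl0 i : p i 0 = 1. Proof. by []. Qed.

Lemma pcl_gt i k : ((d i)./2 < k)%N -> p i k = 0.
Proof. by move=> lt; rewrite /pcl pterm_gt. Qed.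

Lemma comp_pcl k : (0 < k)%N -> prod_part p k = 0.
Proof.
move=> k0; have /congr_rel/clsP := @sigma_p R m d k k0.
rewrite cls_sum; apply: etrans; apply: eq_bigr => c _; exact/esym/cls_prod.
Qed.

Lemma ecl_odd i : odd (d i) -> e i = 0.
Proof. by move=> di; apply/clsP/congr_rel/sigma_odd. Qed.

Lemma ecl_sqr i : ~~ odd (d i) -> e i * e i = ptop R d i.
Proof. by move=> di; rewrite /ecl /gen -clsM; apply/clsP/congr_rel/sigma_even. Qed.

Lemma prod_ecl : all_even d -> \prod_i e i = 0.
Proof.
move/forallP => ev_d; have /congr_rel/clsP := @sigma_prod R m d ev_d.
by rewrite cls_prod.
Qed.

Lemma esig_sqr S : S \subset evens d ->
  esig d R S * esig d R S = \prod_(i in S) ptop R d i.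
Proof.
move/subsetP=> SE; rewrite -big_split; apply: eq_bigr => i /SE.
by rewrite inE => /ecl_sqr.
Qed.

Lemma esigU1 i S : i \notin S -> esig d R (i |: S) = e i * esig d R S.
Proof. by move=> iS; rewrite /esig big_setU1. Qed.

Lemma esigD1 i S : i \in S -> esig d R S = e i * esig d R (S :\ i).
Proof. by move=> iS; rewrite -esigU1 ?setD1K ?setD11. Qed.

Inductive esum : Sigma R d -> Prop :=
| esum0 : esum 0
| esumD x y : esum x -> esum y -> esum (x + y)
| esumE a S : subalg iota p a -> S \subset evens d -> esum (a * esig d R S).

Lemma esumM x y : subalg iota p x -> esum y -> esum (x * y).
Proof.
move=> Ax; elim=> [|u v _ iu _ iv|a S Aa SE]; rewrite ?mulr0 ?mulrDr.
- exact: esum0.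
- exact: esumD.
- by rewrite mulrA; apply: esumE => //; exact: subalgM.
Qed.

Lemma esum_ecl i y : esum y -> esum (e i * y).
Proof.
have [di _|di] := boolP (odd (d i)).
  by rewrite ecl_odd // mul0r; exact: esum0.
elim=> [|u v _ iu _ iv|a S Aa SE]; rewrite ?mulr0 ?mulrDr.
- exact: esum0.
- exact: esumD.
have iE : i \in evens d by rewrite inE.
rewrite mulrCA; have [iS|iS] := boolP (i \in S); last first.
  by rewrite -esigU1 //; apply: esumE => //; rewrite subUset sub1set iE.
rewrite (esigD1 iS) (mulrA (e i) (e i)) ecl_sqr // mulrA; apply: esumE.
  by apply: subalgM => //; exact: subalg_gen.
by apply: subset_trans SE; rewrite subsetDl.
Qed.

Lemma esumP x : esum x.
Proof.
elim/presW: x => t; rewrite -[cls _ t]mulr1.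
have : esum 1.
  have -> : 1 = 1 * esig d R set0 by rewrite /esig big_set0 mulr1.
  by apply: esumE; [exact: subalg1 | exact: sub0set].
(* With 1 generalised to any [y], the claim becomes stability under left multiplication by [t],
   which passes to sums and products of terms. *)
move: 1; elim: t => [r|[i j|i]|s IHs u IHu|s IHs u IHu] y sy.
- by apply: esumM => //; exact: (subalgC iota).
- have -> : cls (@sigma_rel R m d) (Gen (GenP j)) = p i j.+1.
    by rewrite /pcl /pterm insubT // => lt; congr (cls _ (Gen (GenP _))); apply/val_inj.
  by apply: esumM => //; exact: subalg_gen.
- exact: esum_ecl.
- by rewrite clsD mulrDl; apply: esumD; [exact: IHs | exact: IHu].
- by rewrite clsM -mulrA; apply: IHs; exact: IHu.
Qed.

Variable w0 : seq 'I_m.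
Hypothesis w0P : is_content d w0.

Lemma topE i : top p w0 i = ptop R d i.
Proof. by rewrite /top w0P. Qed.

Lemma ann_gens0 : ann_gens p (fun x => x = 0) w0.
Proof. by split=> [j s|k /comp_pcl//]; rewrite w0P => /pcl_gt. Qed.

Lemma ideal0 A : is_ideal A (fun x : Sigma R d => x = 0).
Proof. by split=> // [x y -> ->|a x _ ->]; rewrite ?addr0 ?mulr0. Qed.

Lemma prod_ptop : w0 != [::] -> \prod_i ptop R d i = 0.
Proof.
move/(ideal_prod_top (ideal0 (subalg iota p)) ann_gens0) => <-.
by apply: eq_bigr => i _; rewrite topE.
Qed.

Definition sigma_gens (TT : {set 'I_m} -> {set 'I_m}) x : Prop :=
  exists S w, [/\ S \subset evens d, perm_eq w w0, head_in (TT S) w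
    & x = esig d R S * schub_in p (TT S) w].

(** The empty content is separate: there the product of the top classes over [S] is 1, so the
    remainder of [span_step] would say nothing, while [span_schub] leaves none. *)
Lemma subalg_span S a : subalg iota p a -> exists s r,
  [/\ span iota (span_set p S w0) s, a = s + r
    & r = 0 \/ w0 != [::] /\ exists g, r = (\prod_(j in S) ptop R d j) * g].
Proof.
move=> Aa; case: (eqVneq w0 [::]) => [w00|w0n].
  have [s [_ [sps -> ->]]] := span_schub pcl0 (ideal0 _) ann_gens0 Aa.
  exists s, 0; split=> //; last by left.
  rewrite -[s]mul1r; apply: span_mull sps => y [w [ew _ ->]].
  rewrite mul1r -[schub_in _ _ _]mul1r -(rmorph1 iota); apply: spanZ.
  exists w; move: ew; rewrite w00 => /perm_nilP->; split=> //.
have IH k I f : k \in w0 -> is_ideal (subalg iota p) I ->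
    ann_gens p I (rem k w0) -> subalg iota p f ->
    exists s i, [/\ span iota (span_set p setT (rem k w0)) s, I i & f = s + i].
  by move=> _ idI annI Af; exact: (span_schub pcl0 idI annI Af).
have [s [g [_ [sps _ -> ->]]]] := span_step pcl0 IH S (ideal0 _) ann_gens0 Aa.
exists s, ((\prod_(j in S) top p w0 j) * g); split; rewrite ?addr0 //.
right; split=> //; exists g; congr (_ * _).
by apply: eq_bigr => j _; exact: topE.
Qed.

(** The choice of first letters [TT] is left open: [top_set] with the zero ideal gives the basis,
    and [quo_top_set] gives the quotient by the generator of the annihilator. *)
Lemma sigma_span (TT : {set 'I_m} -> {set 'I_m}) (J : Sigma R d -> Prop) x :
  is_ideal (fun=> True) J ->
  (w0 != [::] -> forall S, S \subset evens d ->
     J ((\prod_(j in TT S) ptop R d j) * esig d R S)) ->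
  exists s i, [/\ span iota (sigma_gens TT) s, J i & x = s + i].
Proof.
move=> [J0 JD JM] Jtop; elim: (esumP x) => {x} [|x y _ [s [i [ss Ji ->]]] _
    [s' [i' [ss' Ji' ->]]]|a S Aa SE].
- by exists 0, 0; rewrite addr0; split=> //; exact: span0.
- by exists (s + s'), (i + i'); rewrite addrACA; split; [exact: spanD|exact: JD|].
have [s [r [sps -> rE]]] := subalg_span (TT S) Aa.
exists (esig d R S * s), (r * esig d R S); rewrite mulrDl [s * _]mulrC; split=> //.
  apply: span_mull sps => y [w [ew hw ->]].
  rewrite -[_ * _]mul1r -(rmorph1 iota); apply: spanZ.
  by exists S, w.
case: rE => [->|[/Jtop JS [g ->]]]; first by rewrite mul0r.
by rewrite mulrAC mulrC; apply: JM => //; exact: JS.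
Qed.

Lemma sigma_span_sum (TT : {set 'I_m} -> {set 'I_m}) x : span iota (sigma_gens TT) x ->
  exists c : {set 'I_m} -> seq 'I_m -> R, x =
  \sum_(S : {set 'I_m} | S \subset evens d)
    \sum_(w <- permutations w0 | head_in (TT S) w)
      iota (c S w) * (esig d R S * schub_in p (TT S) w).
Proof.
elim=> {x} [|x y _ [c1 ->] _ [c2 ->]|a _ [S [w [SE ew hw ->]]]].
- exists (fun _ _ => 0); rewrite big1 // => S _; rewrite big1 // => w _.
  by rewrite rmorph0 mul0r.
- exists (fun S w => c1 S w + c2 S w); rewrite -big_split.
  apply: eq_bigr => S _; rewrite -big_split; apply: eq_bigr => w _.
  by rewrite rmorphD mulrDl.
exists (fun S' w' => if (S' == S) && (w' == w) then a else 0).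
rewrite (bigD1 S) //= [X in _ + X]big1 ?addr0; last first.
  move=> S' /andP[_ /negPf->]; rewrite big1 // => w' _.
  by rewrite rmorph0 mul0r.
rewrite eqxx /= big_mkcond (bigD1_seq w) ?permutations_uniq ?mem_permutations //=.
rewrite hw eqxx big1 ?addr0 // => w' /negPf->.
by rewrite rmorph0 mul0r if_same.
Qed.

End SigmaSpan.

(** * Annihilators in Sigma_D *)

Section SigmaAnn.
Variables (m : nat) (d : 'I_m -> nat) (R : comNzRingType).
Implicit Types (S U : {set 'I_m}) (w : seq 'I_m) (x y : Sigma R d).

Notation p := (pcl R d).
Notation e := (ecl R d).
Let iota : {rmorphism R -> Sigma R d} := cst (@sigma_rel R m d).

Variables (w0 : seq 'I_m) (im : 'I_m).
Hypotheses (w0P : is_content d w0) (w0n : w0 != [::]).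
Hypotheses (im_max : forall j : 'I_m, (j <= im)%N) (im_even : im \in evens d).

Definition toggle S : {set 'I_m} := if im \in S then S :\ im else im |: S.

Lemma toggleK : involutive toggle.
Proof.
move=> S; rewrite /toggle; have [iS|iS] := boolP (im \in S).
  by rewrite setD11 setD1K.
by rewrite setU11 setU1K.
Qed.

Lemma toggle_evens S : (toggle S \subset evens d) = (S \subset evens d).
Proof.
suff le U : U \subset evens d -> toggle U \subset evens d.
  by apply/idP/idP => /le //; rewrite toggleK.
rewrite /toggle; case: ifP => _ UE.
  by apply: subset_trans UE; rewrite subsetDl.
by rewrite subUset sub1set im_even.
Qed.

(** The first letters for which multiplication by e_m carries the generators for [S] to basis
    elements for [toggle S]. If m lies in [S], the square of e_m supplies p_top(D_m), which is
    therefore left out here. *)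
Definition quo_top_set S : {set 'I_m} :=
  if im \in S then top_set d (toggle S) :\ im else top_set d (toggle S).

Lemma top_set_toggle S : im \in S -> im \in top_set d (toggle S).
Proof.
move=> iS; rewrite /top_set /toggle iS; case: ifP; rewrite ?inE ?eqxx //.
Qed.

Lemma ecl_gens S w : perm_eq w w0 -> head_in (quo_top_set S) w ->
  e im * (esig d R S * schub_in p (quo_top_set S) w) =
  esig d R (toggle S) * schub_in p (top_set d (toggle S)) w.
Proof.
case: w => [|k w] ew; first by move/perm_size: ew; case: (w0) w0n.
rewrite mulrA /quo_top_set /toggle; have [iS|iS] := boolP (im \in S); last first.
  by rewrite -esigU1.
move=> hk; have {hk} [kim kT] : k != im /\ k \in top_set d (S :\ im).
  by move: hk; rewrite /= in_setD1 => /andP[].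
have := top_set_toggle iS; rewrite /toggle iS => imT.
rewrite (esigD1 d R iS) (mulrA (e im)) ecl_sqr; last by move: im_even; rewrite inE.
rewrite mulrAC mulrC; congr (_ * _).
rewrite !(schub_perm p _ ew) mulrA; congr (_ * _).
(* The class p_top(D_m) belongs to the first factor of the word because [im] is the largest letter
   and differs from [k]. *)
rewrite [RHS](bigD1 im) /=; last first.
  by rewrite imT ltn_neqAle im_max andbT.
rewrite /top w0P; congr (_ * _); apply: eq_bigl => j.
by rewrite !inE -!andbA; case: eqP => //= _; rewrite ?andbF ?andbT.
Qed.

(** Modulo [x], any [s] is a combination [s'] of the generators for [quo_top_set]. Multiplication by
    e_m sends these to distinct basis elements, so [e im * s' = 0] forces [s' = 0]. *)
Lemma sigma_ann x : e im * x = 0 ->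
  (forall S, S \subset evens d -> exists y,
     (\prod_(j in quo_top_set S) ptop R d j) * esig d R S = x * y) ->
  forall s, e im * s = 0 -> exists y, s = x * y.
Proof.
move=> ex Jtop s es; pose J z := exists y, z = x * y.
have idJ : is_ideal (fun=> True) J.
  split; first by exists 0; rewrite mulr0.
    by move=> _ _ [a ->] [b ->]; exists (a + b); rewrite mulrDr.
  by move=> a _ _ [b ->]; exists (a * b); rewrite mulrCA.
have [s' [_ [ss [y ->] sE]]] := sigma_span w0P s idJ (fun _ => Jtop).
exists y; rewrite sE; suff -> : s' = 0 by rewrite add0r.
have [c s'E] := sigma_span_sum ss.
have es' : e im * s' = 0.
  by move: es; rewrite sE mulrDr mulrA ex mul0r addr0.
(* The coefficients of [e im * s'] in the basis, with 0 at the basis elements that are not images of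
   generators. *)
pose c' S w := if head_in (quo_top_set (toggle S)) w then c (toggle S) w else 0.
have c'0 : forall S w, S \subset evens d -> perm_eq w w0 ->
    head_in (top_set d S) w -> c' S w = 0.
  apply: (sigma_free w0P); first by rewrite w0n orbT.
  rewrite -[RHS]es' s'E mulr_sumr [RHS](reindex_inj (inv_inj toggleK)) /=.
  apply: eq_big => [S|S _]; first by rewrite toggle_evens.
  rewrite mulr_sumr big_mkcond [RHS]big_mkcond big_seq [RHS]big_seq.
  apply: eq_bigr => w; rewrite mem_permutations => ew.
  rewrite /c'; have [hw|hw] := boolP (head_in (quo_top_set _) w).
    rewrite mulrCA ecl_gens // toggleK ifT //.
    move: hw; rewrite /quo_top_set toggleK; case: ifP => // _.
    by case: (w) => //= k w'; rewrite inE => /andP[].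
  by rewrite rmorph0 mul0r if_same.
rewrite s'E big1 // => S SE; rewrite big_seq_cond big1 // => w.
rewrite mem_permutations => /andP[ew hw].
have := c'0 (toggle S) w; rewrite toggle_evens /c' toggleK hw => -> //.
  by rewrite rmorph0 mul0r.
move: hw; rewrite /quo_top_set; case: ifP => // _.
by case: (w) => //= k w'; rewrite inE => /andP[].
Qed.

Let imE : ~~ odd (d im). Proof. by move: im_even; rewrite inE. Qed.

(** Here [quo_top_set S] is the complement C of the union of [S] and m. The product of its top
    classes is the square of e_C, and the generator is e_C times the product of e_j over [S] without
    m. *)
Lemma sigma_ann_even s : all_even d -> e im * s = 0 ->
  exists y, s = (\prod_(j | j != im) e j) * y.
Proof.
move=> ev_d; have allE S : S \subset evens d.
  by apply/subsetP => i _; rewrite inE; move/forallP: ev_d.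
have esigE : \prod_(j | j != im) e j = esig d R (~: [set im]).
  by apply: eq_bigl => j; rewrite !inE.
apply: sigma_ann.
  by rewrite esigE -esigU1 ?inE ?eqxx // /esig -[RHS](prod_ecl R ev_d);
     apply: eq_bigl => j; rewrite !inE; case: eqP.
have splitE S : im \notin S ->
    \prod_(j | j != im) e j = esig d R S * esig d R (~: (im |: S)).
  move=> iS; rewrite /esig (bigID (mem S)); congr (_ * _); apply: eq_bigl => j.
    by rewrite /=; case: eqP => // ->; rewrite (negPf iS).
  by rewrite !inE negb_or.
move=> S _; rewrite /quo_top_set /top_set ev_d /toggle.
have [iS|iS] := boolP (im \in S); last first.
  exists (esig d R (~: (im |: S))); rewrite (splitE S iS) -mulrA esig_sqr //.
  by rewrite mulrC.
exists (e im * esig d R (~: S)); rewrite (splitE (S :\ im)) ?setD11 // setD1K //.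
rewrite (esigD1 d R iS) (_ : ~: (S :\ im) :\ im = ~: S).
  by rewrite -esig_sqr //; ring.
by apply/setP => j; rewrite !inE; case: eqP => [->|]; rewrite ?iS.
Qed.

(** If m lies in [S], then e_S contributes the e_m of the generator and [quo_top_set S] contributes
    the top classes. Otherwise the product of all top classes occurs, which is zero. *)
Lemma sigma_ann_odd s : ~~ all_even d -> e im * s = 0 ->
  exists y, s = (e im * \prod_(j | j != im) ptop R d j) * y.
Proof.
move=> odd_d.
have tops : ptop R d im * \prod_(j | j != im) ptop R d j = 0.
  by rewrite -(prod_ptop R w0P w0n) [RHS](bigD1 im).
apply: sigma_ann; first by rewrite mulrA ecl_sqr.
move=> S _; rewrite /quo_top_set /top_set (negPf odd_d) /toggle.
case: ifP => iS; last first.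
  exists 0; rewrite mulr0.
  rewrite (eq_bigl predT) => [|j]; last by rewrite inE.
  by rewrite (prod_ptop R w0P w0n) mul0r.
exists (esig d R (S :\ im)); rewrite (esigD1 d R iS) mulrA; congr (_ * _).
by rewrite mulrC; congr (_ * _); apply: eq_bigl => j; rewrite !inE andbT.
Qed.

End SigmaAnn.

(** * The exterior algebra *)

(** The number 2^l, in a form that lets the index types split like the blocks of a matrix. *)
Fixpoint extdim (l : nat) : nat :=
  if l is l'.+1 then (extdim l' + extdim l')%N else 1%N.

Lemma split_lshift n1 n2 (k : 'I_n1) : fintype.split (lshift n2 k) = inl k.
Proof. exact: (@unsplitK n1 n2 (inl k)). Qed.

Lemma split_rshift n1 n2 (k : 'I_n2) : fintype.split (rshift n1 k) = inr k.
Proof. exact: (@unsplitK n1 n2 (inr k)). Qed.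

Lemma sum_extdimS (V : nmodType) l (F : 'I_(extdim l.+1) -> V) :
  \sum_i F i = \sum_(i < extdim l) F (lshift (extdim l) i) +
               \sum_(i < extdim l) F (rshift (extdim l) i).
Proof. exact: big_split_ord. Qed.

Section ExteriorBasis.
Variable T : pzRingType.

(** The monomials with increasing indices. The two halves of the index range are those without and
    with the first generator. *)
Fixpoint extbas (l : nat) : ('I_l -> T) -> 'I_(extdim l) -> T :=
  match l with
  | 0 => fun _ _ => 1
  | l'.+1 => fun g k =>
      match fintype.split k with
      | inl k' => extbas (g \o lift ord0) k'
      | inr k' => g ord0 * extbas (g \o lift ord0) k'
      end
  end.

Lemma extbas_lshift l (g : 'I_l.+1 -> T) k :
  extbas g (lshift (extdim l) k) = extbas (g \o lift ord0) k.
Proof. by rewrite /= split_lshift. Qed.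

Lemma extbas_rshift l (g : 'I_l.+1 -> T) k :
  extbas g (rshift (extdim l) k) = g ord0 * extbas (g \o lift ord0) k.
Proof. by rewrite /= split_rshift. Qed.

Lemma extbas1 l (g : 'I_l -> T) : exists k, extbas g k = 1.
Proof.
elim: l g => [|l IH] g; first by exists ord0.
by have [k kE] := IH (g \o lift ord0); exists (lshift _ k); rewrite extbas_lshift.
Qed.

Lemma eq_extbas l (g g' : 'I_l -> T) : g =1 g' -> extbas g =1 extbas g'.
Proof.
elim: l g g' => [|l IH] g g' gg' k //=.
have e : g \o lift ord0 =1 g' \o lift ord0 by move=> j; exact: gg'.
by case: (fintype.split k) => k'; rewrite (IH _ _ e) ?gg'.
Qed.

Variables (R : comPzRingType) (iota : {rmorphism R -> T}).
Hypothesis iota_central : forall r x, iota r * x = x * iota r.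

(** The first generator maps the first half of the monomials to the second and kills the second. The
    others preserve both halves, with a sign on the second from passing the first generator. *)
Lemma extbas_span l (g : 'I_l -> T) :
  (forall j, g j * g j = 0) -> (forall i j, g i * g j = - (g j * g i)) ->
  forall j k, exists c : 'I_(extdim l) -> R,
    g j * extbas g k = \sum_i iota (c i) * extbas g i.
Proof.
elim: l g => [|l IH] g gg gC j k; first by case: j.
have {}IH := IH (g \o lift ord0) (fun i => gg _) (fun i i' => gC _ _).
case: (unliftP ord0 j) => [j'|] ->.
  case: (split_ordP k) => k' ->.
    have [c cE] := IH j' k'.
    exists (fun i => if fintype.split i is inl i' then c i' else 0).
    rewrite extbas_lshift sum_extdimS /= [X in _ + X]big1 ?addr0 => [|i _].
      rewrite [LHS]cE; apply: eq_bigr => i _.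
      by rewrite split_lshift.
    by rewrite split_rshift rmorph0 mul0r.
  have [c cE] := IH j' k'.
  exists (fun i => if fintype.split i is inr i' then - c i' else 0).
  rewrite extbas_rshift sum_extdimS /= [X in X + _]big1 ?add0r => [|i _].
    rewrite mulrA gC mulNr -mulrA [X in - (_ * X)]cE mulr_sumr -sumrN.
    apply: eq_bigr => i _; rewrite split_rshift rmorphN mulNr; congr (- _).
    by rewrite !mulrA iota_central.
  by rewrite split_lshift rmorph0 mul0r.
case: (split_ordP k) => k' ->.
  exists (fun i => (i == rshift _ k')%:R); rewrite (bigD1 (rshift _ k')) //= big1.
    by rewrite eqxx rmorph1 mul1r addr0 split_lshift split_rshift.
  by move=> i /negPf->; rewrite rmorph0 mul0r.
exists (fun=> 0); rewrite extbas_rshift mulrA gg mul0r big1 // => i _.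
by rewrite rmorph0 mul0r.
Qed.

End ExteriorBasis.

Lemma extbas_morph (T T' : pzRingType) (f : T -> T') l (g : 'I_l -> T) k :
  f 1 = 1 -> {morph f : x y / x * y} -> f (extbas g k) = extbas (f \o g) k.
Proof.
move=> f1 fM; elim: l g k => [|l IH] g k //=.
by case: (fintype.split k) => k'; rewrite ?fM IH.
Qed.

(** * The exterior algebra acting on its monomials *)

Section ExteriorMatrices.
Variable R : comPzRingType.

(** The matrices of left multiplication by the generators on [extbas]. *)
Fixpoint extmx (l : nat) : 'I_l -> 'M[R]_(extdim l) :=
  match l with
  | 0 => fun=> 0
  | l'.+1 => fun j =>
      match unlift ord0 j with
      | None => block_mx 0 0 1%:M 0
      | Some j' => block_mx (extmx j') 0 0 (- extmx j')
      end
  end.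

Lemma extmx0 l : extmx (@ord0 l) = block_mx 0 0 1%:M 0.
Proof. by rewrite /= unlift_none. Qed.

Lemma extmx_lift l (j : 'I_l) :
  extmx (lift ord0 j) = block_mx (extmx j) 0 0 (- extmx j).
Proof. by rewrite /= liftK. Qed.

(** The combination has diagonal blocks [V] and [- V] and a scalar block below. [V] squares to zero
    by induction, and the scalar commutes with [V], so the lower left block cancels. *)
Lemma extmx_sqr l (c : 'I_l -> R) :
  (\sum_j (c j)%:M *m extmx j) *m (\sum_j (c j)%:M *m extmx j) = 0.
Proof.
elim: l c => [|l IH] c; first by rewrite big_ord0 mul0mx.
pose V := \sum_(j < l) (c (lift ord0 j))%:M *m extmx j.
have -> : \sum_j (c j)%:M *m extmx j = block_mx V 0 (c ord0)%:M (- V).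
  rewrite big_ord_recl extmx0.
  have sumE (A B : 'I_l -> 'M[R]_(extdim l)) :
      \sum_i block_mx (A i) 0 0 (B i) = block_mx (\sum_i A i) 0 0 (\sum_i B i).
    apply: (big_ind3 (fun x y z => z = block_mx x 0 0 y)) => //.
      by rewrite -[RHS]/(block_mx 0 0 0 0) block_mx0.
    by move=> ? ? ? ? ? ? -> ->; rewrite add_block_mx !addr0.
  rewrite (eq_bigr (fun j => block_mx ((c (lift ord0 j))%:M *m extmx j) 0 0
                              (- ((c (lift ord0 j))%:M *m extmx j)))).
    rewrite sumE -sumrN -/V scalar_mx_block mulmx_block add_block_mx.
    by rewrite !(mul0mx, mulmx0, mulmx1, addr0, add0r).
  move=> j _; rewrite extmx_lift scalar_mx_block mulmx_block.
  by rewrite !(mul0mx, mulmx0, addr0, add0r) mulmxN.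
rewrite mulmx_block !(mul0mx, mulmx0, addr0, add0r) !mulNmx !mulmxN opprK.
have -> : V *m V = 0 by exact: IH.
by rewrite scalar_mxC subrr; exact: block_mx0.
Qed.

(** The coordinate vector of the monomial 1. *)
Fixpoint vacuum (l : nat) : 'cV[R]_(extdim l) :=
  if l is l'.+1 then col_mx (vacuum l') 0 else 1%:M.

Lemma extbas_block l n (A B : 'I_l -> 'M[R]_n) k :
  extbas (fun j => block_mx (A j) 0 0 (B j) : 'M_(n + n)) k =
  block_mx (extbas A k) 0 0 (extbas B k).
Proof.
elim: l A B k => [|l IH] A B k /=; first by rewrite -scalar_mx_block.
case: (fintype.split k) => k'; rewrite IH //.
by rewrite -!mulmxE mulmx_block !(mul0mx, mulmx0, addr0, add0r).
Qed.

Lemma extbas_vacuum l (k : 'I_(extdim l)) :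
  extbas (@extmx l) k *m vacuum l = delta_mx k 0.
Proof.
elim: l k => [|l IH] k.
  by rewrite /=; apply/matrixP => i j; rewrite mul1mx !mxE !ord1.
have bE k' : extbas (@extmx l.+1 \o lift ord0) k' =
    block_mx (extbas (@extmx l) k') 0 0 (extbas (fun j => - @extmx l j) k').
  rewrite -extbas_block; apply: eq_extbas => j /=; exact: extmx_lift.
case: (split_ordP k) => k' ->.
  rewrite extbas_lshift bE [vacuum _]/=.
  rewrite mul_block_col !(mul0mx, mulmx0, addr0) IH.
  apply/matrixP => i j; case: (split_ordP i) => i' ->.
    by rewrite col_mxEu !mxE eq_lshift.
  by rewrite col_mxEd !mxE eq_rlshift.
rewrite extbas_rshift bE [vacuum _]/= -mulmxE extmx0 mulmx_block mul_block_col.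
rewrite !(mul0mx, mulmx0, mul1mx, addr0, add0r) IH.
apply/matrixP => i j; case: (split_ordP i) => i' ->.
  by rewrite col_mxEu !mxE eq_lrshift.
by rewrite col_mxEd !mxE eq_rshift.
Qed.

End ExteriorMatrices.

(** * Tensor products *)

Section TensorStructure.
Variables (R : comPzRingType) (A B : pzRingType).
Variables (iA : {rmorphism R -> A}) (iB : {rmorphism R -> B}).

Notation tensAB := (tens iA iB).
Notation iW := (cst (tensor_rel iA iB)).

Lemma tensDl a a' b : tensAB (a + a') b = tensAB a b + tensAB a' b.
Proof. by rewrite /tens /gen -clsD; apply/clsP/congr_rel/tensor_Dl. Qed.

Lemma tensDr a b b' : tensAB a (b + b') = tensAB a b + tensAB a b'.
Proof. by rewrite /tens /gen -clsD; apply/clsP/congr_rel/tensor_Dr. Qed.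

Lemma tensZl r a b : tensAB (iA r * a) b = iW r * tensAB a b.
Proof. by rewrite /tens /gen -clsM; apply/clsP/congr_rel/tensor_Zl. Qed.

Lemma tensZr r a b : tensAB a (iB r * b) = iW r * tensAB a b.
Proof. by rewrite /tens /gen -clsM; apply/clsP/congr_rel/tensor_Zr. Qed.

Lemma tens11 : tensAB 1 1 = 1.
Proof. by apply/clsP/congr_rel/tensor_one. Qed.

Lemma tensM a a' b b' : tensAB a b * tensAB a' b' = tensAB (a * a') (b * b').
Proof. by rewrite /tens /gen -clsM; apply/clsP/congr_rel/tensor_mul. Qed.

Lemma tens0l b : tensAB 0 b = 0.
Proof. by apply: (addIr (tensAB 0 b)); rewrite -tensDl !add0r. Qed.

Lemma tens0r a : tensAB a 0 = 0.
Proof. by apply: (addIr (tensAB a 0)); rewrite -tensDr !add0r. Qed.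

Lemma tens_suml (I : Type) (r : seq I) (P : pred I) F b :
  tensAB (\sum_(i <- r | P i) F i) b = \sum_(i <- r | P i) tensAB (F i) b.
Proof. by apply: (big_morph (tensAB^~ b)) => [a a'|]; rewrite ?tensDl ?tens0l. Qed.

Lemma tens_sumr (I : Type) (r : seq I) (P : pred I) F a :
  tensAB a (\sum_(i <- r | P i) F i) = \sum_(i <- r | P i) tensAB a (F i).
Proof. by apply: (big_morph (tensAB a)) => [b b'|]; rewrite ?tensDr ?tens0r. Qed.

Variables (n : nat) (beta : 'I_n -> B).
Hypothesis beta_span : forall b, exists c : 'I_n -> R, b = \sum_k iB (c k) * beta k.

Lemma tens_span (w : tensor iA iB) :
  exists s : 'I_n -> A, w = \sum_k tensAB (s k) (beta k).
Proof.
pose D x := exists s : 'I_n -> A, x = \sum_k tensAB (s k) (beta k).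
have spanD x y : D x -> D y -> D (x + y).
  move=> [s ->] [s' ->]; exists (fun k => s k + s' k).
  by rewrite -big_split; apply: eq_bigr => k _; rewrite tensDl.
have span_tens a b : D (tensAB a b).
  have [c ->] := beta_span b; exists (fun k => iA (c k) * a).
  by rewrite tens_sumr; apply: eq_bigr => k _; rewrite tensZl tensZr.
have span0 : D 0.
  by exists (fun=> 0); rewrite big1 // => k _; rewrite tens0l.
have : D 1 by rewrite -tens11; exact: span_tens.
rewrite -/(D w); elim/presW: w => t; rewrite -[cls _ t]mulr1.
move: 1; elim: t => [r|[a b]|t IHt u IHu|t IHt u IHu] y sy.
- have [s ->] := sy; exists (fun k => iA r * s k).
  by rewrite mulr_sumr; apply: eq_bigr => k _; rewrite tensZl.
- have [s ->] := sy; rewrite mulr_sumr; apply: (big_ind D) => // k _.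
  by rewrite -[cls _ _]/(tensAB a b) tensM; exact: span_tens.
- by rewrite clsD mulrDl; apply: spanD; [exact: IHt | exact: IHu].
- by rewrite clsM -mulrA; apply: IHt; exact: IHu.
Qed.

End TensorStructure.

Section ExteriorAlgebra.
Variables (R : comPzRingType) (l : nat).

Notation iL := (cst (@ext_rel R 'I_l)).
Notation L := (exterior R 'I_l).
Let gL (j : 'I_l) : L := gen (@ext_rel R 'I_l) j.

Definition ext_basis : 'I_(extdim l) -> L := extbas gL.

Lemma ext_sqr (c : 'I_l -> R) :
  (\sum_j iL (c j) * gL j) * (\sum_j iL (c j) * gL j) = 0.
Proof.
have /congr_rel/clsP := @ext_square R _ c; rewrite clsM cls_sum.
by apply: etrans; congr (_ * _); apply: eq_bigr => j _; rewrite clsM.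
Qed.

Lemma ext_gen_sqr j : gL j * gL j = 0.
Proof.
have := ext_sqr (fun i => (i == j)%:R).
rewrite (bigD1 j) //= eqxx rmorph1 mul1r big1 ?addr0 // => i /negPf->.
by rewrite rmorph0 mul0r.
Qed.

(** Polarisation of the square of the sum of the two generators. *)
Lemma ext_gen_anticomm i j : gL i * gL j = - (gL j * gL i).
Proof.
have [->|ij] := eqVneq i j; first by rewrite ext_gen_sqr oppr0.
have := ext_sqr (fun k => (k == i)%:R + (k == j)%:R).
rewrite (bigD1 i) //= (bigD1 j) /=; last by rewrite eq_sym.
rewrite !eqxx (negPf ij) eq_sym (negPf ij) addr0 add0r rmorph1 !mul1r.
rewrite big1 => [|k /andP[/negPf-> /negPf->]]; last by rewrite addr0 rmorph0 mul0r.
rewrite addr0 mulrDl !mulrDr !ext_gen_sqr add0r addr0 => /eqP.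
by rewrite addr_eq0 => /eqP.
Qed.

Lemma ext_span (b : L) : exists c : 'I_(extdim l) -> R,
  b = \sum_k iL (c k) * ext_basis k.
Proof.
pose D x := exists c : 'I_(extdim l) -> R, x = \sum_k iL (c k) * ext_basis k.
have spD x y : D x -> D y -> D (x + y).
  move=> [c ->] [c' ->]; exists (fun k => c k + c' k).
  by rewrite -big_split; apply: eq_bigr => k _; rewrite rmorphD mulrDl.
have spZ r y : D y -> D (iL r * y).
  move=> [c ->]; exists (fun k => r * c k).
  by rewrite mulr_sumr; apply: eq_bigr => k _; rewrite rmorphM mulrA.
have sp0 : D 0.
  by exists (fun=> 0); rewrite big1 // => k _; rewrite rmorph0 mul0r.
have : D 1.
  have [k kE] := extbas1 gL.
  exists (fun i => (i == k)%:R); rewrite (bigD1 k) //= big1 => [|i /negPf->].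
    by rewrite eqxx rmorph1 mul1r addr0 /ext_basis kE.
  by rewrite rmorph0 mul0r.
rewrite -/(D b); elim/presW: b => t; rewrite -[cls _ t]mulr1.
move: 1; elim: t => [r|j|t IHt u IHu|t IHt u IHu] y sy.
- exact: spZ.
- have [c ->] := sy; rewrite mulr_sumr; apply: (big_ind D) => // k _.
  rewrite mulrA -cst_central -mulrA; apply: spZ.
  exact: (extbas_span (@cst_central _ _ _) ext_gen_sqr ext_gen_anticomm).
- by rewrite clsD mulrDl; apply: spD; [exact: IHt | exact: IHu].
- by rewrite clsM -mulrA; apply: IHt; exact: IHu.
Qed.

End ExteriorAlgebra.

(** * Coordinates on the tensor product with an exterior algebra *)

Section Coordinates.
Variables (R A : comPzRingType) (iA : {rmorphism R -> A}) (l : nat).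

Notation iL := (cst (@ext_rel R 'I_l)).
Notation L := (exterior R 'I_l).
Let gL (j : 'I_l) : L := gen (@ext_rel R 'I_l) j.
Let M := 'M[A]_(extdim l).
Let iM : {rmorphism R -> M} := @scalar_mx A (extdim l) \o iA.

Let iM_central r (x : M) : iM r * x = x * iM r.
Proof. by rewrite /= -!mulmxE scalar_mxC. Qed.

Let ev_sound (G : Type) (g : G -> M) (rel : term R G -> term R G -> Prop) :
  (forall s t, rel s t -> ev iM g s = ev iM g t) ->
  forall s t, congr rel s t -> ev iM g s = ev iM g t.
Proof.
move=> h s t /(ev_congr iM_central (g := g) (N := fun x => x = 0)) e.
apply/eqP; rewrite -subr_eq0; apply/eqP; apply: e => //.
- by move=> x y -> ->; rewrite addr0.
- by move=> a x ->; rewrite mulr0.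
- by move=> a x ->; rewrite mul0r.
- by move=> s' t' /h->; rewrite subrr.
Qed.

Let evL (b : L) : M := ev iM (@extmx A l) (repr b).

Let evLE t : evL (cls _ t) = ev iM (@extmx A l) t.
Proof.
apply: ev_sound (congr_repr _ t) => s u [c] /=; rewrite rmorph0.
have -> : ev iM (@extmx A l) (\big[Add/Cst 0]_j Mul (Cst (c j)) (Gen j)) =
    \sum_j (iA (c j))%:M *m extmx A j.
  by rewrite ev_sum.
rewrite raddf0; exact: (extmx_sqr (fun j => iA (c j))).
Qed.

Let evLD b b' : evL (b + b') = evL b + evL b'.
Proof. by elim/presW: b => s; elim/presW: b' => t; rewrite -clsD !evLE. Qed.

Let evLM b b' : evL (b * b') = evL b * evL b'.
Proof. by elim/presW: b => s; elim/presW: b' => t; rewrite -clsM !evLE. Qed.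

Let evL_cst r : evL (iL r) = iM r.
Proof. exact: evLE. Qed.

Let evL1 : evL 1 = 1.
Proof. by rewrite -(rmorph1 iM) -evL_cst. Qed.

Let gW (ab : A * L) : M := ab.1%:M *m evL ab.2.

Let evW (w : tensor iA iL) : M := ev iM gW (repr w).

Let evWE t : evW (cls _ t) = ev iM gW t.
Proof.
apply: ev_sound (congr_repr _ t) => s u [] /=; rewrite /gW /= => *.
- by rewrite raddfD mulmxDl.
- by rewrite evLD mulmxDr.
- by rewrite scalar_mxM -mulmxA.
- by rewrite evLM evL_cst -!mulmxE /= mulmxA scalar_mxC mulmxA.
- by rewrite evL1 mulmx1 rmorph1.
- rewrite evLM -!mulmxE scalar_mxM -!mulmxA; congr (_ *m _).
  by rewrite !mulmxA scalar_mxC.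
Qed.

(** The tensor product acts on column vectors over [A], with [A] acting by scalars and the
    generators by [extmx]. The image of [vacuum] shows the coordinates. *)
Lemma tens_coord : exists coord : tensor iA iL -> 'I_(extdim l) -> A,
  forall s : 'I_(extdim l) -> A,
    coord (\sum_k tens iA iL (s k) (ext_basis R k)) =1 s.
Proof.
exists (fun w k => (evW w *m vacuum A l) k 0) => s k.
have evW_sum : evW (\sum_k tens iA iL (s k) (ext_basis R k)) =
    \sum_k (s k)%:M *m evL (ext_basis R k).
  transitivity (\sum_k evW (tens iA iL (s k) (ext_basis R k))).
    apply: (big_morph evW) => [x y|]; last by rewrite evWE /= !rmorph0.
    by elim/presW: x => t; elim/presW: y => u; rewrite -clsD !evWE.
  by apply: eq_bigr => i _; exact: evWE.
have evL_basis i : evL (ext_basis R i) = extbas (@extmx A l) i.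
  rewrite /ext_basis (extbas_morph _ _ evL1 evLM).
  by apply: eq_extbas => j; rewrite /= evLE.
have term_k i : ((s i)%:M *m evL (ext_basis R i) *m vacuum A l) k 0 =
    s i * (k == i)%:R.
  by rewrite -mulmxA evL_basis extbas_vacuum mul_scalar_mx !mxE eqxx andbT.
rewrite evW_sum mulmx_suml summxE (bigD1 k) //= term_k eqxx mulr1.
by rewrite big1 ?addr0 // => i ik; rewrite term_k eq_sym (negPf ik) mulr0.
Qed.

End Coordinates.

(** * The algebra W_D *)

Section Free.
Variables (R : comPzRingType) (V : lmodType R).

Lemma is_free_fin (I : finType) (b : I -> V) :
  (forall v, exists c : I -> R, v = \sum_i c i *: b i) ->
  (forall c : I -> R, \sum_i c i *: b i = 0 -> forall i, c i = 0) ->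
  is_free V.
Proof.
move=> spb freeb; exists I, b => v.
have sumE (f : {fsfun I -> R with 0}) :
    \sum_(i <- finsupp f) f i *: b i = \sum_i f i *: b i.
  rewrite big_uniq ?fset_uniq //= big_mkcond; apply: eq_bigr => i _.
  by rewrite mem_finsupp; case: eqP => //= ->; rewrite scale0r.
have [c vE] := spb v.
exists [fsfun i in [fset i | i in I]%fset => c i]; split.
  rewrite sumE vE; apply: eq_bigr => i _; rewrite fsfunE.
  by rewrite !inE.
move=> f; rewrite sumE vE => vf; apply/fsfunP => i.
rewrite fsfunE !inE /=; apply/esym/eqP; rewrite -subr_eq0; apply/eqP.
apply: (freeb (fun i => f i - c i)).
by under eq_bigr do rewrite scalerBl; rewrite sumrB vf subrr.
Qed.

Lemma is_free_trivial : (forall v : V, v = 0) -> is_free V.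
Proof.
move=> V0; exists void, (fun=> 0) => v; exists [fsfun]; split.
  exact: etrans (V0 _) (esym (V0 _)).
by move=> f _; apply/fsfunP => -[].
Qed.

End Free.

Lemma sum_seq_sub (T : choiceType) (V : nmodType) (L : seq T) (F : T -> V) :
  uniq L -> \sum_(i : seq_sub L) F (ssval i) = \sum_(x <- L) F x.
Proof.
move=> uL; rewrite -(big_map (@ssval _ L) predT).
apply/perm_big/uniq_perm => //.
  by rewrite map_inj_uniq ?index_enum_uniq //; exact: val_inj.
move=> x; apply/mapP/idP => [[y _ ->]|xL]; first exact: ssvalP.
by exists (SeqSub xL); rewrite ?mem_index_enum.
Qed.

Section Homogeneous.
Variables (R A : pzRingType) (iA : {rmorphism R -> A}) (base : nat -> A -> Prop).

Lemma homog1 : Defs.homog iA base 0 1.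
Proof. by rewrite -(rmorph1 iA); exact: homog_cst. Qed.

Lemma homog_prod (I : Type) (r : seq I) (P : pred I) (f : I -> nat) (F : I -> A) :
  (forall i, P i -> Defs.homog iA base (f i) (F i)) ->
  Defs.homog iA base (\sum_(i <- r | P i) f i)%N (\prod_(i <- r | P i) F i).
Proof.
move=> h; apply: (big_ind2 (Defs.homog iA base)) => //; first exact: homog1.
by move=> k a l b; exact: homog_mul.
Qed.

End Homogeneous.

(** * Transfer from Sigma_D to W_D *)

Section WStructure.
Variables (R : comPzRingType) (m : nat) (d : 'I_m -> nat).

Notation iS := (cst (@sigma_rel R m d)).
Let l := (rankn d - rankq d)%N.
Notation tensW := (tens iS (cst (@ext_rel R 'I_l))).

Lemma W_span (w : W R d) : exists s : 'I_(extdim l) -> Sigma R d,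
  w = \sum_k tensW (s k) (ext_basis R k).
Proof. by apply: tens_span; exact: ext_span. Qed.

Lemma W_coord : exists coord : W R d -> 'I_(extdim l) -> Sigma R d,
  forall s : 'I_(extdim l) -> Sigma R d,
    coord (\sum_k tensW (s k) (ext_basis R k)) =1 s.
Proof. exact: (@tens_coord R (Sigma R d) iS l). Qed.

Lemma sigmaWM (a : Sigma R d) (s : 'I_(extdim l) -> Sigma R d) :
  sigmaW a * (\sum_k tensW (s k) (ext_basis R k)) =
  \sum_k tensW (a * s k) (ext_basis R k).
Proof.
by rewrite mulr_sumr; apply: eq_bigr => k _; rewrite /sigmaW tensM mul1r.
Qed.

Lemma sigmaW_central (a : Sigma R d) (w : W R d) : sigmaW a * w = w * sigmaW a.
Proof.
have [s ->] := W_span w; rewrite sigmaWM mulr_suml.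
by apply: eq_bigr => k _; rewrite /sigmaW tensM mulr1 mulrC.
Qed.

Lemma sigmaW_mul (a b : Sigma R d) : sigmaW a * sigmaW b = sigmaW (a * b).
Proof. by rewrite /sigmaW tensM mulr1. Qed.

(** By [W_span] and [W_coord] the exterior monomials form a basis over Sigma_D, so annihilation and
    divisibility are checked on coordinates. *)
Lemma W_annihilator (a x : Sigma R d) : a * x = 0 ->
  (forall s, a * s = 0 -> exists y, s = x * y) ->
  annihilator (sigmaW a) = principal_ideal (sigmaW x).
Proof.
move=> ax ann; apply/funext => w; apply/propext; split.
  have [s ->] := W_span w; rewrite /annihilator /= sigmaWM => as0.
  have [coord coordE] := W_coord.
  have {}as0 k : a * s k = 0.
    rewrite -(coordE (fun k => a * s k) k) as0 -[RHS](coordE (fun=> 0) k).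
    by congr (coord _ k); rewrite big1 // => i _; rewrite tens0l.
  have [y yE] := fin_all_exists (fun k => ann _ (as0 k)).
  exists [seq (1, tensW (y k) (ext_basis R k)) | k <- enum 'I_(extdim l)].
  rewrite big_map big_enum /=; apply: eq_bigr => k _.
  by rewrite mul1r /sigmaW tensM mul1r yE.
case=> s ->; rewrite /annihilator /= mulr_sumr big1 // => u _.
by rewrite !mulrA sigmaW_central -(mulrA u.1) sigmaW_mul ax /sigmaW tens0l mulr0 mul0r.
Qed.

Lemma W_free (I : finType) (b : I -> Sigma R d) :
  (forall s, exists c : I -> R, s = \sum_i iS (c i) * b i) ->
  (forall c : I -> R, \sum_i iS (c i) * b i = 0 -> forall i, c i = 0) ->
  is_free (W R d).
Proof.
move=> bspan bfree.
pose B (ki : 'I_(extdim l) * I) := tensW (b ki.2) (ext_basis R ki.1).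
have sumB (c : 'I_(extdim l) * I -> R) : \sum_ki (c ki *: B ki : W R d) =
    \sum_k tensW (\sum_i iS (c (k, i)) * b i) (ext_basis R k).
  transitivity (\sum_k \sum_i c (k, i) *: (B (k, i) : W R d)).
    by rewrite pair_bigA; apply: eq_bigr => -[k i] _.
  apply: eq_bigr => k _; rewrite tens_suml; apply: eq_bigr => i _.
  by rewrite tensZl cst_scale.
apply: (@is_free_fin R (W R d) _ B) => [w|c].
  have [s ->] := W_span w; have [c cE] := fin_all_exists (fun k => bspan (s k)).
  exists (fun ki => c ki.1 ki.2); rewrite sumB.
  by apply: eq_bigr => k _; rewrite cE.
rewrite sumB => sum0 [k i]; apply: (bfree (fun i => c (k, i))).
have [coord coordE] := W_coord.
rewrite -(coordE (fun k => \sum_i iS (c (k, i)) * b i) k) sum0.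
rewrite -[RHS](coordE (fun=> 0) k).
by congr (coord _ k); rewrite big1 // => j _; rewrite tens0l.
Qed.

Lemma W_homog_sigma k a :
  pres_homog (rel := @sigma_rel R m d) (@sigma_deg m d) k a ->
  W_homog k (sigmaW a).
Proof.
move=> ha; apply: homog_base; exists k, 0%N, a, 1.
by split=> //; [exact: homog1 | rewrite addn0].
Qed.

Let homS := pres_homog (rel := @sigma_rel R m d) (@sigma_deg m d).

Lemma ecl_homog i : homS (d i) (ecl R d i).
Proof. by apply: homog_base; exists (GenE d i). Qed.

Lemma ptop_homog i : homS (4 * (d i)./2) (ptop R d i).
Proof.
rewrite /ptop /pcl; case: (_./2) => [|k]; first by rewrite muln0; exact: homog1.
rewrite /pterm; case: insubP => [j _ jk|_].
  by apply: homog_base; exists (GenP j); rewrite //= jk.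
exact: homog_zero.
Qed.

End WStructure.

(** The independence argument uses polynomials over a nonzero ring. Over the zero ring W_D
    vanishes. *)
Lemma comPzRing_dichotomy (P : comPzRingType -> Prop) :
  (forall R : comPzRingType, 1 = 0 :> R -> P R) ->
  (forall R : comNzRingType, P R) -> forall R : comPzRingType, P R.
Proof.
move=> Ptriv Pnz R; have [/Ptriv //|nz] := eqVneq (1 : R) 0.
case: R nz => T [? ? ? ? ? ? ? ? ? ? ?]; set R0 := (X in P X) => nz.
pose R' : comNzRingType := HB.pack R0 (GRing.PzSemiRing_isNonZero.Build R0 nz).
exact: (Pnz R').
Qed.

(** * Freeness of W_D *)

Section Assembly.
Variables (m : nat) (d : 'I_m -> nat).

Definition content_word : seq 'I_m :=
  flatten [seq nseq (d i)./2 i | i <- enum 'I_m].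

Lemma content_wordP : is_content d content_word.
Proof.
move=> j; rewrite count_flatten -map_comp sumnE big_map big_enum /=.
rewrite (bigD1 j) //= count_nseq /= eqxx mul1n big1 ?addn0 // => i ij.
by rewrite count_nseq /= (negPf ij).
Qed.

Lemma content_word_neq0 : (0 < rankq d)%N -> content_word != [::].
Proof.
apply: contraTneq => w0; rewrite lt0n negbK /rankq big1 // => i _.
by rewrite -content_wordP w0.
Qed.

Lemma all_evenP : reflect (forall i, ~~ odd (d i)) (all_even d).
Proof. exact: forallP. Qed.

Lemma W_trivial (R : comPzRingType) (x : Sigma R d) :
  1 = 0 :> Sigma R d -> is_free (W R d) /\
  forall a : Sigma R d, annihilator (sigmaW a) = principal_ideal (sigmaW x).
Proof.
move=> e10; have W0 (w : W R d) : w = 0.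
  have [s ->] := W_span w; rewrite big1 // => k _.
  by rewrite -[s k]mul1r e10 mul0r tens0l.
split; first exact: is_free_trivial.
move=> a; apply/funext => w; apply/propext; rewrite (W0 w); split=> _.
  by exists [::]; rewrite big_nil.
by rewrite /annihilator /= mulr0.
Qed.

(** All d_i are 0 here, so each top class is p_0 = 1. Their product is the square of the product of
    all e_i, which is zero. *)
Lemma Sigma_trivial (R : comPzRingType) :
  all_even d -> content_word = [::] -> 1 = 0 :> Sigma R d.
Proof.
move=> ev_d w0; have p1 i : ptop R d i = 1.
  by rewrite /ptop -content_wordP w0 pcl0.
have evT : setT \subset evens d.
  by apply/subsetP => i _; rewrite inE; move/all_evenP: ev_d.
transitivity (\prod_(i in [set: 'I_m]) ptop R d i).
  by rewrite big1.
rewrite -esig_sqr // (_ : esig d R _ = 0) ?mul0r //.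
rewrite -(prod_ecl R ev_d); apply: eq_bigl => i; by rewrite inE.
Qed.

(** If all d_i are even, the top classes outside [S] multiply to the square of the complementary
    product of Euler classes, and this times e_S contains the product of all e_i. Otherwise all top
    classes occur. *)
Lemma basis_rel (R : comPzRingType) (S : {set 'I_m}) :
  S \subset evens d -> content_word != [::] ->
  (\prod_(j in top_set d S) ptop R d j) * esig d R S = 0.
Proof.
move=> SE w0; rewrite /top_set; case: ifP => ev_d; last first.
  rewrite (eq_bigl predT) => [|j]; last by rewrite inE.
  by rewrite (prod_ptop R content_wordP w0) mul0r.
have CE : ~: S \subset evens d.
  by apply/subsetP => i _; rewrite inE; move/all_evenP: ev_d.
rewrite -esig_sqr // -mulrA [_ * esig d R S]mulrC.
suff -> : esig d R S * esig d R (~: S) = 0 by rewrite mulr0.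
rewrite -(prod_ecl R ev_d) [RHS](bigID (mem S)); congr (_ * _).
by apply: eq_bigl => j; rewrite !inE.
Qed.

Lemma W_is_free (R : comPzRingType) : is_free (W R d).
Proof.
elim/comPzRing_dichotomy: R => R.
  move=> R0; have [] // := @W_trivial R 0; rewrite -(rmorph1 (cst (@sigma_rel R m d))).
  by rewrite R0 rmorph0.
have [nondeg|] := boolP (~~ all_even d || (content_word != [::])); last first.
  rewrite negb_or !negbK => /andP[ev_d /eqP w0].
  by have [] := W_trivial 0 (Sigma_trivial R ev_d w0).
pose L0 := [seq (U, w) | U : {set 'I_m} <- index_enum _,
                         w : seq 'I_m <- permutations content_word].
pose L := [seq Sw : {set 'I_m} * seq 'I_m <- L0 |
  (Sw.1 \subset evens d) && head_in (top_set d Sw.1) Sw.2].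
have uL : uniq L.
  apply/filter_uniq/allpairs_uniq => //; first exact: index_enum_uniq.
    exact: permutations_uniq.
  by move=> [S w] [S' w'].
pose F (Sw : {set 'I_m} * seq 'I_m) :=
  esig d R Sw.1 * schub_in (pcl R d) (top_set d Sw.1) Sw.2.
have sumL (c : {set 'I_m} -> seq 'I_m -> R) :
    \sum_(i : seq_sub L) cst _ (c (ssval i).1 (ssval i).2) * F (ssval i) =
    \sum_(S : {set 'I_m} | S \subset evens d)
      \sum_(w <- permutations content_word | head_in (top_set d S) w)
        cst _ (c S w) * (esig d R S * schub_in (pcl R d) (top_set d S) w).
  rewrite (sum_seq_sub (fun Sw => cst _ (c Sw.1 Sw.2) * F Sw)) // /L big_filter /L0.
  rewrite big_mkcond big_allpairs /= [RHS]big_mkcond; apply: eq_bigr => S _.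
  case: ifP => _ /=; last by rewrite big1.
  by rewrite -big_mkcond.
apply: (@W_free R m d (seq_sub L) (fun i => F (ssval i))) => [s|c sum0 i].
  have [|s' [_ [ss -> ->]]] := sigma_span content_wordP (TT := top_set d) s
      (ideal0 (fun=> True)).
    by move=> w0 S SE; exact: basis_rel.
  have [c ->] := sigma_span_sum ss.
  by exists (fun i => c (ssval i).1 (ssval i).2); rewrite sumL addr0.
pose c' S w := if insub (S, w) is Some i then c i else 0.
have c'E j : c' (ssval j).1 (ssval j).2 = c j.
  by rewrite /c' -surjective_pairing -[ssval j]/(val j) valK.
rewrite -c'E; have := ssvalP i; rewrite mem_filter => /andP[/andP[SE hw]].
case/allpairsP => -[S w] [_ wp iE]; rewrite iE /= in SE hw *.
apply: (sigma_free content_wordP nondeg _ SE) => //; last by rewrite -mem_permutations.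
rewrite -sumL -[RHS]sum0; apply: eq_bigr => j _.
by rewrite c'E.
Qed.

End Assembly.

Lemma Sigma_trivial_base (R : comPzRingType) (m : nat) (d : 'I_m -> nat) :
  1 = 0 :> R -> 1 = 0 :> Sigma R d.
Proof.
by move=> R0; rewrite -(rmorph1 (cst (@sigma_rel R m d))) R0 rmorph0.
Qed.

(** * Annihilators in W_D *)

Section Annihilators.
Variables (m : nat) (d : 'I_m -> nat) (im : 'I_m).
Hypotheses (im_last : im.+1 = m) (im_even : ~~ odd (d im)).

Let im_max (j : 'I_m) : (j <= im)%N.
Proof. by rewrite -ltnS im_last. Qed.

Let im_evens : im \in evens d.
Proof. by rewrite inE. Qed.

Lemma annihilator_even (R : comPzRingType) : all_even d ->
  annihilator (sigmaW (ecl R d im)) =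
  principal_ideal (sigmaW (\prod_(j | j != im) ecl R d j)).
Proof.
move=> ev_d; have [/(Sigma_trivial R ev_d) S0|w0] := eqVneq (content_word d) [::].
  by have [_] := W_trivial (\prod_(j | j != im) ecl R d j) S0; exact.
elim/comPzRing_dichotomy: R => R.
  move/(Sigma_trivial_base d)/(W_trivial (\prod_(j | j != im) ecl R d j)).
  by case=> _; exact.
apply: W_annihilator.
  by rewrite -(prod_ecl R ev_d) [RHS](bigD1 im).
by move=> s; apply: sigma_ann_even (content_wordP d) w0 im_max im_evens _ ev_d.
Qed.

(** If q = 0, then d_m = 0 and the square of e_m is p_0 = 1. The proposed generator is then the unit
    e_m, although only 0 is annihilated by e_m. Positive q makes the product of all top classes
    vanish. *)
Lemma annihilator_odd (R : comPzRingType) : ~~ all_even d -> (0 < rankq d)%N ->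
  annihilator (sigmaW (ecl R d im)) =
  principal_ideal (sigmaW (ecl R d im * \prod_(j | j != im) ptop R d j)).
Proof.
move=> odd_d /content_word_neq0 w0; elim/comPzRing_dichotomy: R => R.
  move/(Sigma_trivial_base d).
  move/(W_trivial (ecl R d im * \prod_(j | j != im) ptop R d j)).
  by case=> _; exact.
apply: W_annihilator.
  by rewrite mulrA ecl_sqr // -(prod_ptop R (content_wordP d) w0) [RHS](bigD1 im).
by move=> s; apply: sigma_ann_odd (content_wordP d) w0 im_max im_evens _ odd_d.
Qed.

End Annihilators.

Theorem theorem6p24 (R : comPzRingType) (m : nat) (d : 'I_m -> nat) :
  is_free (W R d) /\
  forall im : 'I_m, im.+1 = m -> ~~ odd (d im) ->
    ((forall j, ~~ odd (d j)) ->
       let x := sigmaW (\prod_(j | j != im) ecl R d j) in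
       annihilator (sigmaW (ecl R d im)) = principal_ideal x /\
       W_homog (dimN d - d im) x) /\
    (~ (forall j, ~~ odd (d j)) ->
       let x := sigmaW (ecl R d im * \prod_(j | j != im) ptop R d j) in
       ((0 < rankq d)%N ->
          annihilator (sigmaW (ecl R d im)) = principal_ideal x) /\
       W_homog (4 * rankq d - d im) x).
Proof.
split; first exact: W_is_free.
move=> im im_last im_even; split=> [/all_evenP ev_d|/all_evenP odd_d] x; split.
- exact: annihilator_even.
- apply: W_homog_sigma; rewrite /dimN (bigD1 im) //= addKn.
  by apply: homog_prod => j _; exact: ecl_homog.
- exact: annihilator_odd.
- apply: W_homog_sigma.
  (* As d_m is even, its contribution to 4q is 2 d_m, and d_m is left after the subtraction. *)
  have -> : (4 * rankq d - d im = d im + \sum_(j | j != im) 4 * (d j)./2)%N.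
    rewrite /rankq (bigD1 im) //= mulnDr -big_distrr /=.
    have := odd_double_half (d im); rewrite (negPf im_even) add0n -muln2 => <-.
    by rewrite muln2 doubleK; lia.
  apply: homog_mul; first exact: ecl_homog.
  by apply: homog_prod => j _; exact: ptop_homog.
Qed.
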